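(* Let $j\ge1$ be fixed. There exists $\gamma_0^{[j-1]}>0$ such that, for $\gamma\in\mathbf{R}$, $C_j(\xi_{j-1}(\gamma))$ is positive if $\gamma<\gamma_0^{[j-1]}$ and negative if $\gamma>\gamma_0^{[j-1]}$.
   Context: For $\gamma,\sigma\in\mathbf{R}$, $\mu_1(\gamma,\sigma)<\mu_2(\gamma,\sigma)<\cdots$ are the (simple) eigenvalues of the self-adjoint operator $-\frac{d^2}{dt^2}+(t-\sigma)^2$ on $L^2(\mathbf{R}_+)$ with boundary condition $u'(0)=\gamma u(0)$, and $u_j^{[\gamma,\sigma]}$ is a real $L^2$-normalized eigenfunction associated with $\mu_j(\gamma,\sigma)$. The function $\mu_j(\gamma,\cdot)$ has a unique minimum, attained at $\sigma=\xi_{j-1}(\gamma)$. The function $C_j$ (depending on $\gamma$) is defined by $$C_j(\sigma)=\Big\langle\big((\tau-\sigma)\tau^2-\partial_\tau-2\tau(\sigma-\tau)^2\big)u_j^{[\gamma,\sigma]}(\tau),\,u_j^{[\gamma,\sigma]}(\tau)\Big\rangle_{L^2(\mathbf{R}_+)}.$$ *)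

(* Defs.v *)
From HB Require Import structures.
From mathcomp Require Import all_boot all_order all_algebra.
From mathcomp Require Import all_classical all_reals all_analysis.
Set Implicit Arguments.
Unset Strict Implicit.
Unset Printing Implicit Defensive.
Import Order.TTheory GRing.Theory Num.Theory.
Import numFieldNormedType.Exports.
Local Open Scope classical_set_scope.
Local Open Scope ring_scope.

(* Functions on R_+ are represented by functions R -> R whose values on the
   negative half-line are irrelevant. *)
Definition Rplus (R : realType) : set R := `[0, +oo[.

Definition L2_Rplus (R : realType) (f : R -> R) : Prop :=
  f \_ (@Rplus R) \in Lfun (@lebesgue_measure R) 2%:E.

Definition dot_Rplus (R : realType) (f g : R -> R) : R :=
  \int[@lebesgue_measure R]_(t in @Rplus R) (f t * g t).

(* f is locally absolutely continuous on R_+, with a.e. derivative f'. *)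
Definition primitive_Rplus (R : realType) (f f' : R -> R) : Prop :=
  forall t : R, 0 <= t ->
    (@lebesgue_measure R).-integrable `[0, t] (EFin \o f') /\
    f t = f 0 + \int[@lebesgue_measure R]_(s in `[0, t]) f' s.

(* The graph of the self-adjoint operator -d^2/dt^2 + (t - sigma)^2 with
   boundary condition u'(0) = gamma u(0): u belongs to its (maximal) domain and
   is mapped to f.  An element of the domain is represented by its C^1
   representative u; u1 is the continuous representative of u', so that u1 0 is
   the boundary value u'(0), and u2 is the a.e. derivative of u1. *)
Definition robin_graph (R : realType) (gamma sigma : R) (u f : R -> R) : Prop :=
  [/\ L2_Rplus u, L2_Rplus f &
    exists u1 u2 : R -> R,
      [/\ primitive_Rplus u u1,
          primitive_Rplus u1 u2,
          u1 0 = gamma * u 0 &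
          {ae @lebesgue_measure R, forall t : R, Rplus t ->
             f t = - u2 t + (t - sigma) ^+ 2 * u t}]].

Definition robin_eigenvalue (R : realType) (gamma sigma lambda : R) : Prop :=
  exists u : R -> R,
    robin_graph gamma sigma u (fun t => lambda * u t) /\
    ~ {ae @lebesgue_measure R, forall t : R, Rplus t -> u t = 0}.

Definition normalized_eigenfunction (R : realType) (gamma sigma lambda : R)
    (u : R -> R) : Prop :=
  robin_graph gamma sigma u (fun t => lambda * u t) /\ dot_Rplus u u = 1.

(* The indices of the sequence start at 1; the value at 0 is irrelevant. *)
Definition robin_spectrum (R : realType) (gamma sigma : R) (m : nat -> R) : Prop :=
  (forall j k : nat, (1 <= j)%N -> (j < k)%N -> m j < m k) /\
  (forall lambda : R, robin_eigenvalue gamma sigma lambda <->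
     exists2 j : nat, (1 <= j)%N & lambda = m j).

Definition unique_minimum_at (R : realType) (f : R -> R) (x : R) : Prop :=
  forall y : R, y != x -> f x < f y.

(* <((tau - sigma) tau^2 - d/dtau - 2 tau (sigma - tau)^2) u, u> in L^2(R_+).
   The two-sided derivative is that of u at every tau > 0. *)
Definition Cfun (R : realType) (sigma : R) (u : R -> R) : R :=
  dot_Rplus (fun tau => (tau - sigma) * tau ^+ 2 * u tau - derive1 u tau
                        - 2 * tau * (sigma - tau) ^+ 2 * u tau) u.

(* Main.v *)
Require Import Defs.
From HB Require Import structures.
From mathcomp Require Import all_boot all_order all_algebra.
From mathcomp Require Import ring lra.
From mathcomp Require Import all_classical all_reals all_analysis measurable_realfun.
Set Implicit Arguments.
Unset Strict Implicit.
Unset Printing Implicit Defensive.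
Import Order.TTheory GRing.Theory Num.Theory.
Import numFieldNormedType.Exports.
Local Open Scope classical_set_scope.
Local Open Scope ring_scope.

(** On [R_+] the eigenfunctions are translates [D l (t - s)] of the solutions of
    [D'' = (x^2 - l) D] that decay at [+oo].  These are built, continuously in [l],
    from the integral representation of the Hermite functions of negative order and
    the creation operator.  Then [l] is an eigenvalue at [(g, s)] iff
    [D' l (- s) = g D l (- s)].  The identity
    [D_l D_k' - D_l' D_k = (k - l) int D_l D_k] makes the zeros in [l] of this
    boundary condition simple and interlacing, so that [mu_j] is increasing in [g],
    and the minimum in [s] can only occur where [mu_j = s^2 - g^2].  There the
    integrand of [C_j] has a primitive quadratic in [(u, u')], which gives
    [C_j = u(0)^2 (1 - g s) / 3].  Finally [xi^2 = min mu_j + g^2] is increasing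
    in [g >= 0] and [xi > 0], so [g xi(g)] crosses 1 exactly once. *)

(** * Calculus on the line and on half-lines *)

(** The hypotheses give [mu] only as the ordered spectrum at each pair [(g, s)], and say nothing
    about how it varies. Every fact about [mu_j] is therefore obtained by producing a zero in [l] of
    [D' l (- s) - g D l (- s)] in a prescribed place and ranking it among the eigenvalues, by
    induction on the index. Derivatives in [l] are bypassed as well: continuity in [l] and the
    Wronskian identity give the sign of increments, which is what monotonicity and the intermediate
    value theorem consume. At a zero, the [x]-derivative of [D' - g D] is [(x^2 - l - g^2) D]. If it
    is nonzero, a small move of [s] to the appropriate side lowers the zero, which a minimum
    forbids; hence [mu_j = s^2 - g^2] there. The integral representation is used for [l < -1], and
    each creation operator raises this bound by 2. Families thus carry an upper bound [L], chosen
    after the eigenvalue under study. Since [xi] comes with no regularity in [g], the threshold is a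
    supremum, and strict monotonicity of [g xi(g)] decides the sign on both sides of it. *)

Lemma is_derive_add (R : realType) (f g : R -> R) (x a b : R) :
  is_derive x 1 f a -> is_derive x 1 g b ->
  is_derive x 1 (fun y => f y + g y) (a + b).
Proof. by move=> hf hg; exact: (is_deriveD hf hg). Qed.

Lemma is_derive_opp (R : realType) (f : R -> R) (x a : R) :
  is_derive x 1 f a -> is_derive x 1 (fun y => - f y) (- a).
Proof. by move=> hf; exact: (is_deriveN hf). Qed.

Lemma is_derive_mul (R : realType) (f g : R -> R) (x a b : R) :
  is_derive x 1 f a -> is_derive x 1 g b ->
  is_derive x 1 (fun y => f y * g y) (f x * b + g x * a).
Proof. by move=> hf hg; exact: (is_deriveM hf hg). Qed.

Lemma is_derive_pow (R : realType) (f : R -> R) (n : nat) (x a : R) :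
  is_derive x 1 f a ->
  is_derive x 1 (fun y => f y ^+ n.+1) (n.+1%:R * f x ^+ n * a).
Proof.
move=> hf; have := is_deriveX n.+1 hf.
by rewrite exprfctE.
Qed.

Lemma is_derive_exp (R : realType) (f : R -> R) (x a : R) :
  is_derive x 1 f a -> is_derive x 1 (fun y => expR (f y)) (a * expR (f x)).
Proof.
move=> hf; have := is_derive1_comp (is_derive_expR (f x)) hf.
by rewrite mulrC.
Qed.

Lemma is_derive_const (R : realType) (c x : R) :
  is_derive x 1 (fun _ : R => c) 0.
Proof. exact: is_derive_cst. Qed.

Lemma is_derive_var (R : realType) (x : R) : is_derive x 1 (fun y : R => y) 1.
Proof. exact: is_derive_id. Qed.

Lemma is_derive_affine (R : realType) (f : R -> R) (s x a : R) :
  is_derive (x - s) 1 f a -> is_derive x 1 (fun y => f (y - s)) a.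
Proof.
move=> hf.
have hs : is_derive x 1 (fun y : R => y - s) (1 + 0).
  exact: (@is_derive_add _ (fun y => y) (fun _ => - s)).
by have := @is_derive1_comp R f (fun y => y - s) x a _ hf hs; rewrite addr0 mulr1.
Qed.

Lemma is_derive_conv (R : realType) (f : R -> R) (x a b : R) :
  is_derive x 1 f a -> a = b -> is_derive x 1 f b.
Proof. by move=> hf <-. Qed.

(** Differentiates structurally into a metavariable, taking unknown functions from the context;
    [der] leaves as its main goal the equality between the computed and the claimed derivative. *)
Ltac der1 :=
  match goal with
  | |- is_derive _ _ (fun _ => ?c) _ => exact: is_derive_const
  | |- is_derive _ _ (fun y => y) _ => exact: is_derive_var
  | |- is_derive _ _ (fun y => @?f y + @?g y) _ =>
      notypeclasses refine (@is_derive_add _ f g _ _ _ _ _)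
  | |- is_derive _ _ (fun y => - @?f y) _ =>
      notypeclasses refine (@is_derive_opp _ f _ _ _)
  | |- is_derive _ _ (fun y => @?f y * @?g y) _ =>
      notypeclasses refine (@is_derive_mul _ f g _ _ _ _ _)
  | |- is_derive _ _ (fun y => @?f y ^+ S ?n) _ =>
      notypeclasses refine (@is_derive_pow _ f n _ _ _)
  | |- is_derive _ _ (fun y => expR (@?f y)) _ =>
      notypeclasses refine (@is_derive_exp _ f _ _ _)
  | |- is_derive _ _ (fun y => ?f (y - ?s)) _ =>
      notypeclasses refine (@is_derive_affine _ f s _ _ _)
  | H : _ |- _ => solve [apply H; auto]
  end; cbv beta.
Ltac der := notypeclasses refine (@is_derive_conv _ _ _ _ _ _ _);
  [ cbv beta; repeat der1 | cbv beta ].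

Lemma is_derive_continuous (R : realType) (f : R -> R) (x a : R) :
  is_derive x 1 f a -> {for x, continuous f}.
Proof. by move=> hf; apply/differentiable_continuous/derivable1_diffP. Qed.


Lemma derivative_ge0_le (R : realType) (f g : R -> R) (a b : R) :
  a <= b -> {within `[a, b], continuous f} ->
  (forall x, a < x -> x < b -> is_derive x (1 : R) f (g x)) ->
  (forall x, a < x -> x < b -> 0 <= g x) -> f a <= f b.
Proof.
rewrite le_eqVlt => /predU1P[->//|ab] cf df g0.
have [|c] := @MVT R f g a b ab _ cf.
  by move=> x; rewrite in_itv/= => /andP[ax xb]; exact: df.
rewrite in_itv/= => /andP[ac cb] e.
by rewrite -subr_ge0 e mulr_ge0 ?g0// subr_ge0 ltW.
Qed.

Lemma derivative0_eq (R : realType) (f : R -> R) (a b : R) :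
  a <= b -> {within `[a, b], continuous f} ->
  (forall x, a < x -> x < b -> is_derive x (1 : R) f 0) -> f a = f b.
Proof.
rewrite le_eqVlt => /predU1P[->//|ab] cf df.
have [|c _] := @MVT R f (fun=> 0) a b ab _ cf.
  by move=> x; rewrite in_itv/= => /andP[ax xb]; exact: df.
by rewrite mul0r => /eqP; rewrite subr_eq0 => /eqP.
Qed.

Lemma continuous_within (R : realType) (f : R -> R) (A : set R) :
  (forall x, {for x, continuous f}) -> {within A, continuous f}.
Proof. by move=> cf; apply: continuous_subspaceT. Qed.

Lemma global_derivative_ge0_le (R : realType) (f g : R -> R) (a b : R) :
  (forall x, is_derive x (1 : R) f (g x)) ->
  (forall x, a < x -> x < b -> 0 <= g x) -> a <= b -> f a <= f b.
Proof.
move=> df g0 ab; apply: (@derivative_ge0_le _ _ g) => //.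
by apply: continuous_within => x; exact: is_derive_continuous.
Qed.

Lemma exp_decay_lt (R : realType) (C a e : R) : 0 < e ->
  exists2 x, a <= x & C * expR (- x) < e.
Proof.
move=> e0; pose y := Num.max a (`|C| / e); exists y.
  by rewrite le_max lexx.
have ye : `|C| / e <= y by rewrite le_max lexx orbT.
have y0 : 0 <= y by rewrite (le_trans _ ye)// divr_ge0// ltW.
have h : `|C| < e * expR y.
  rewrite ler_pdivrMr // in ye; apply: (le_lt_trans ye).
  by rewrite mulrC ltr_pM2l// (lt_le_trans _ (expR_ge1Dx y))// ltrDr.
rewrite expRN ltr_pdivrMr ?expR_gt0//; exact: le_lt_trans (ler_norm _) h.
Qed.

(** Energy arguments on [[a, +oo[] end here: a quantity with nonnegative derivative that tends to 0
    must approach 0 from below. *)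
Lemma ndecr_decay_le0 (R : realType) (f : R -> R) (a C : R) :
  (forall x, a <= x -> f a <= f x) ->
  (forall x, a <= x -> `|f x| <= C * expR (- x)) -> f a <= 0.
Proof.
move=> hf hC; rewrite leNgt; apply/negP => fa0.
have [x ax] := exp_decay_lt C a fa0; apply/negP; rewrite -leNgt.
exact: le_trans (hf _ ax) (le_trans (ler_norm _) (hC _ ax)).
Qed.

Lemma cst_decay_eq0 (R : realType) (f : R -> R) (a C : R) :
  (forall x, a <= x -> f a = f x) ->
  (forall x, a <= x -> `|f x| <= C * expR (- x)) -> f a = 0.
Proof.
move=> hf hC; apply/eqP; rewrite eq_le; apply/andP; split.
  by apply: (ndecr_decay_le0 _ hC) => x /hf ->.
rewrite -oppr_le0.
apply: (@ndecr_decay_le0 _ (fun x => - f x) a C) => x ax; first by rewrite (hf x ax).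
by rewrite normrN hC.
Qed.

Lemma decay_cvg0 (R : realType) (f : R -> R) (a C : R) :
  (forall x, a <= x -> `|f x| <= C * expR (- x)) -> f x @[x --> +oo] --> 0.
Proof.
move=> hC; apply/cvgrPdist_le => e e0.
have [y ay ye] := exp_decay_lt `|C| a e0.
near=> x; rewrite sub0r normrN.
have yx : y <= x by near: x; apply: nbhs_pinfty_ge; exact: num_real.
apply: (le_trans (hC _ (le_trans ay yx))); apply: le_trans (ltW ye).
apply: le_trans (_ : `|C| * expR (- x) <= _).
  by rewrite ler_wpM2r ?expR_ge0// ler_norm.
by rewrite ler_wpM2l// ler_expR lerN2.
Unshelve. all: end_near. Qed.

Lemma continuous_measurable_on (R : realType) (f : R -> R) (A : set R) :
  (forall x, {for x, continuous f}) -> measurable A -> measurable_fun A f.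
Proof.
move=> cf mA; apply: measurable_funTS; apply: continuous_measurable_fun; exact: cf.
Qed.

Lemma continuous_expN (R : realType) (x : R) :
  {for x, continuous (fun y : R => expR (- y))}.
Proof. by apply: (@is_derive_continuous _ _ _ (- expR (- x))); der; ring. Qed.

Lemma integral_expN (R : realType) (a : R) :
  (\int[@lebesgue_measure R]_(x in `[a, +oo[) (expR (- x))%:E = (expR (- a))%:E)%E.
Proof.
have d x : is_derive x (1 : R) (fun y => - expR (- y)) (expR (- x)) by der; ring.
rewrite (@ge0_continuous_FTC2y _ _ (fun x => - expR (- x)) a 0).
- by rewrite -EFinB opprK add0r.
- by move=> x _; exact: expR_ge0.
- by apply: continuous_within => x; exact: continuous_expN.
- apply: (@decay_cvg0 _ _ a 1) => x _.
  by rewrite normrN ger0_norm ?expR_ge0// mul1r.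
- by move=> x _; exact: @ex_derive.
- by apply: cvg_at_right_filter; apply: is_derive_continuous.
- by move=> x _; rewrite derive1E; exact: derive_val.
Qed.

Lemma integrable_expN (R : realType) (a : R) :
  (@lebesgue_measure R).-integrable `[a, +oo[ (EFin \o (fun x => expR (- x))).
Proof.
apply/integrableP; split.
  apply/measurable_EFinP; apply: continuous_measurable_on => //.
  exact: continuous_expN.
under eq_integral do rewrite /= ger0_norm ?expR_ge0//.
by rewrite integral_expN ltry.
Qed.

Lemma integrable_scaled_expN (R : realType) (C a : R) :
  (@lebesgue_measure R).-integrable `[a, +oo[
    (EFin \o (fun x => C * expR (- x))).
Proof.
rewrite (_ : _ \o _ = fun x => (C%:E * (EFin \o (fun x => expR (- x))) x)%E).
  exact: integrableZl (integrable_expN a).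
by apply/funext => x /=; rewrite EFinM.
Qed.

Lemma integrable_decay (R : realType) (f : R -> R) (a C : R) :
  measurable_fun `[a, +oo[ f ->
  (forall x, a <= x -> `|f x| <= C * expR (- x)) ->
  (@lebesgue_measure R).-integrable `[a, +oo[ (EFin \o f).
Proof.
move=> mf hC.
apply: le_integrable (integrable_scaled_expN C a) => //.
- exact/measurable_EFinP.
- move=> x /=; rewrite in_itv/= andbT => ax.
  by rewrite lee_fin (le_trans (hC x ax))// ler_norm.
Qed.

Lemma within_continuous_add (R : realType) (f g : R -> R) (A : set R) :
  {within A, continuous f} -> {within A, continuous g} ->
  {within A, continuous (fun x => f x + g x)}.
Proof. by move=> cf cg x; apply: cvgD; [exact: cf|exact: cg]. Qed.

Lemma within_continuous_mul (R : realType) (f g : R -> R) (A : set R) :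
  {within A, continuous f} -> {within A, continuous g} ->
  {within A, continuous (fun x => f x * g x)}.
Proof. by move=> cf cg x; apply: cvgM; [exact: cf|exact: cg]. Qed.

Lemma within_continuous_opp (R : realType) (f : R -> R) (A : set R) :
  {within A, continuous f} -> {within A, continuous (fun x => - f x)}.
Proof. by move=> cf x; apply: cvgN; exact: cf. Qed.

(** The integrand has no sign. Adding [C * expR (- x)], which dominates [|g x|], makes it
    nonnegative, so that the fundamental theorem for nonnegative integrands applies; the known
    integral of the added term is then removed. *)
Lemma Rintegral_decay (R : realType) (G g : R -> R) (a C : R) :
  (forall x, a < x -> is_derive x (1 : R) G (g x)) ->
  {within `[a, +oo[, continuous g} -> G x @[x --> a^'+] --> G a ->
  (forall x, a <= x -> `|G x| <= C * expR (- x)) ->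
  (forall x, a <= x -> `|g x| <= C * expR (- x)) ->
  \int[@lebesgue_measure R]_(x in `[a, +oo[) g x = - G a.
Proof.
move=> dG cg Ga hG hg.
have ig : (@lebesgue_measure R).-integrable `[a, +oo[ (EFin \o g).
  by apply: integrable_decay hg; apply: subspace_continuous_measurable_fun.
have ie : (@lebesgue_measure R).-integrable `[a, +oo[ (EFin \o (fun x => C * expR (- x))).
  exact: integrable_scaled_expN.
have d x : a < x -> is_derive x (1 : R) (fun y => G y - C * expR (- y))
    (g x + C * expR (- x)).
  by move=> ax; have := dG x ax => dGx; der; ring.
have ce x : {for x, continuous (fun y : R => C * expR (- y))}.
  by apply: (@is_derive_continuous _ _ _ (- C * expR (- x))); der; ring.
have H : \int[@lebesgue_measure R]_(x in `[a, +oo[) (g x + C * expR (- x)) =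
    0 - (G a - C * expR (- a)).
  apply: (@Rintegral_ge0_continuous_FTC2y R (fun x => g x + C * expR (- x))
    (fun y => G y - C * expR (- y))).
  - by move=> x /hg; rewrite ler_norml => /andP[+ _]; rewrite -subr_ge0 opprK addrC.
  - by apply: within_continuous_add => //; exact: continuous_within.
  - apply: (@decay_cvg0 _ _ a (C + `|C|)) => x ax.
    rewrite (le_trans (ler_normB _ _))// mulrDl lerD ?hG//.
    by rewrite normrM (ger0_norm (expR_ge0 _)).
  - by move=> x /d; exact: @ex_derive.
  - by apply: cvgB => //; apply: cvg_at_right_filter; exact: ce.
  - move=> x; rewrite in_itv/= andbT => /d dx.
    by rewrite derive1E; exact: derive_val.
have Ie : \int[@lebesgue_measure R]_(x in `[a, +oo[) (C * expR (- x)) =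
    C * expR (- a).
  by rewrite RintegralZl ?/Rintegral ?integral_expN//; exact: integrable_expN.
by move: H; rewrite RintegralD// Ie => H; lra.
Qed.

Lemma Rintegral_ge_segment (R : realType) (f : R -> R) (A : set R) (a b c : R) :
  measurable A -> (@lebesgue_measure R).-integrable A (EFin \o f) ->
  (forall x, A x -> 0 <= f x) -> `[a, b] `<=` A -> a < b -> 0 <= c ->
  (forall x, a <= x -> x <= b -> c <= f x) ->
  c * (b - a) <= \int[@lebesgue_measure R]_(x in A) f x.
Proof.
move=> mA fi f0 abA ab c0 cf.
have mf := measurable_int (@lebesgue_measure R) fi.
rewrite -lee_fin /Rintegral fineK; last exact: integrable_fin_num.
apply: (@le_trans _ _ (\int[@lebesgue_measure R]_(x in `[a, b]) c%:E)%E).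
  by rewrite integral_cst//= lebesgue_measure_itv/= lte_fin ab -EFinD -EFinM.
apply: (@le_trans _ _ (\int[@lebesgue_measure R]_(x in `[a, b]) (f x)%:E)%E).
  apply: ge0_le_integral => //.
  - exact: measurable_funS mf.
  - by move=> x; rewrite /= in_itv/= => /andP[ax xb]; rewrite lee_fin cf.
by apply: ge0_subset_integral => // x Ax; rewrite lee_fin f0.
Qed.

(** * Hermite functions of negative order *)

(** The integral of this kernel over [s > 0] is the Hermite function of order [- p - 1] at [x], up
    to the factor [Gamma(p + 1)]. *)
Definition hkernel (R : realType) (p x s : R) : R :=
  s `^ p * expR (- (2 * x * s) - s ^+ 2).

Definition hermite_int (R : realType) (p x : R) : R :=
  \int[@lebesgue_measure R]_(s in `]0, +oo[) hkernel p x s.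

Lemma hkernel_ge0 (R : realType) (p x s : R) : 0 <= hkernel p x s.
Proof. by rewrite mulr_ge0 ?powR_ge0// expR_ge0. Qed.

Lemma powR_le_exp (R : realType) (p P s : R) :
  0 <= p -> p <= P -> 0 < s -> s `^ p <= expR (P * s).
Proof.
move=> p0 pP s0; rewrite /powR gt_eqF// ler_expR.
apply: (@le_trans _ _ (p * s)); last by rewrite ler_wpM2r// ltW.
by rewrite ler_wpM2l// ltW// ln_sublinear.
Qed.

(** A single majorant for all [p <= P] and [x >= x0], as dominated convergence requires in either
    parameter. It comes from completing the square in [(P - 2 * x0 + 1) * s - s ^+ 2], where the
    [+ 1] pays for the factor [expR (- s)]. *)
Lemma hkernel_le (R : realType) (P x0 p x s : R) :
  0 <= p -> p <= P -> x0 <= x -> 0 < s ->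
  hkernel p x s <= expR ((P - 2 * x0 + 1) ^+ 2) * expR (- s).
Proof.
move=> p0 pP x0x s0; rewrite /hkernel.
apply: (@le_trans _ _ (expR (P * s) * expR (- (2 * x * s) - s ^+ 2))).
  by rewrite ler_wpM2r ?expR_ge0// powR_le_exp.
rewrite -!expRD ler_expR.
have h1 : x0 * s <= x * s by rewrite ler_wpM2r// ltW.
have := sqr_ge0 (P - 2 * x0 + 1 - s).
have := sqr_ge0 (P - 2 * x0 + 1); have := sqr_ge0 s.
rewrite !expr2; lra.
Qed.

Lemma measurable_hkernel (R : realType) (p x : R) (A : set R) :
  measurable A -> measurable_fun A (hkernel p x).
Proof.
move=> mA; apply: measurable_funM.
  by apply: measurable_funTS; exact: measurable_powR.
apply: continuous_measurable_on => // s.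
apply: (@is_derive_continuous _ _ _
  ((- (2 * x) - 2 * s) * expR (- (2 * x * s) - s ^+ 2))).
by der; ring.
Qed.

Lemma integrable_scaled_expN_oo (R : realType) (C : R) :
  (@lebesgue_measure R).-integrable `]0, +oo[
    (EFin \o (fun x => C * expR (- x))).
Proof.
apply: integrableS (integrable_scaled_expN C 0) => //.
by apply: subset_itvr; rewrite bnd_simp.
Qed.

Lemma integrable_hkernel (R : realType) (p x : R) : 0 <= p ->
  (@lebesgue_measure R).-integrable `]0, +oo[ (EFin \o hkernel p x).
Proof.
move=> p0; pose C := expR ((p - 2 * x + 1) ^+ 2).
apply: le_integrable (integrable_scaled_expN_oo C) => //.
  apply/measurable_EFinP; exact: measurable_hkernel.
move=> s /=; rewrite in_itv/= andbT => s0; rewrite lee_fin ger0_norm ?hkernel_ge0//.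
by rewrite (le_trans (hkernel_le p0 (lexx p) (lexx x) s0))// ler_norm.
Qed.

Lemma is_derive_hkernel (R : realType) (p x s : R) : 0 < p -> 0 < s ->
  is_derive x (1 : R) (fun y => hkernel p y s) (- 2 * hkernel (p + 1) x s).
Proof.
move=> p0 s0; rewrite /hkernel.
have -> : s `^ (p + 1) = s `^ p * s.
  by rewrite powRD ?powRr1 ?(ltW s0)// (gt_eqF s0) implybT.
by der; ring.
Qed.

Lemma is_derive_hermite_int (R : realType) (p x : R) : 0 < p ->
  is_derive x (1 : R) (hermite_int p) (- 2 * hermite_int (p + 1) x).
Proof.
(* The constant of [hkernel_le] for the differentiated kernel, of exponent [p + 1], uniform for
   arguments above [x - 1]. *)
move=> p0; pose C := expR ((p + 1 - 2 * (x - 1) + 1) ^+ 2).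
have Ix : `]x - 1, x + 1[%classic x by rewrite /= in_itv/=; lra.
have int_f y : `]x - 1, x + 1[%classic y ->
  (@lebesgue_measure R).-integrable `]0, +oo[ (EFin \o hkernel p y).
  by move=> _; exact: integrable_hkernel (ltW p0).
have der_f y s : `]x - 1, x + 1[%classic y -> `]0, +oo[%classic s ->
    derivable (fun y => hkernel p y s) y 1.
  move=> _; rewrite /= in_itv/= andbT => s0.
  by have := is_derive_hkernel y p0 s0 => h; exact: @ex_derive.
have G0 (s : R) : 0 <= 2 * C * expR (- s) by rewrite !mulr_ge0// expR_ge0.
have iG : (@lebesgue_measure R).-integrable `]0, +oo[
    (EFin \o (fun s => 2 * C * expR (- s))).
  exact: integrable_scaled_expN_oo.
have hG y s : `]x - 1, x + 1[%classic y -> `]0, +oo[%classic s ->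
    `|partial1of2 (hkernel p) y s| <= 2 * C * expR (- s).
  rewrite /= !in_itv/= andbT => /andP[y1 _] s0.
  have h := is_derive_hkernel y p0 s0.
  have k0 := hkernel_ge0 (p + 1) y s.
  rewrite partial1of2E derive_val ler0_norm; last by lra.
  have : hkernel (p + 1) y s <= C * expR (- s) by apply: hkernel_le; lra.
  lra.
have d := @derivable_under_integral R _ _ (@lebesgue_measure R) _ _
  (measurable_itv `]0, +oo[) _ _ _ Ix int_f der_f _ G0 iG hG.
have e := @differentiation_under_integral R _ _ (@lebesgue_measure R) _ _
  (measurable_itv `]0, +oo[) _ _ _ Ix int_f der_f _ G0 iG hG.
split => //; rewrite -derive1E e /hermite_int -RintegralZl//; last first.
  by apply: integrable_hkernel; lra.
apply: eq_Rintegral => s; rewrite inE/= in_itv/= andbT => s0.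
by have h := is_derive_hkernel x p0 s0; rewrite partial1of2E derive_val.
Qed.

Lemma hermite_int_continuous_exponent (R : realType) (p x : R) : 0 < p ->
  {for p, continuous (fun q => hermite_int q x)}.
Proof.
move=> p0; pose C := expR ((p + 1 - 2 * x + 1) ^+ 2).
have Ip : p \in `]0, p + 1[%classic by rewrite inE/= in_itv/=; lra.
have iG : (@lebesgue_measure R).-integrable `]0, +oo[
    (EFin \o (fun s => C * expR (- s))).
  exact: integrable_scaled_expN_oo.
apply: (@continuity_under_integral R _ _ (@lebesgue_measure R)
  (fun q => hkernel q x) _ (measurable_itv `]0, +oo[) _ _ _ _ _ iG _ _ Ip).
- move=> q; rewrite /= in_itv/= => /andP[q0 _].
  exact: integrable_hkernel (ltW q0).
- apply/aeW => s; rewrite /= in_itv/= andbT => s0 q _.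
  apply: continuousM; last exact: cst_continuous.
  have -> : powR s = fun q => expR (q * ln s).
    by apply/funext => r; rewrite /powR gt_eqF.
  by apply: (@is_derive_continuous _ _ _ (ln s * expR (q * ln s))); der; ring.
- move=> q; rewrite /= in_itv/= => /andP[q0 q1].
  apply/aeW => s; rewrite /= in_itv/= andbT => s0.
  by rewrite ger0_norm ?hkernel_ge0//; apply: hkernel_le => //; lra.
Qed.

Lemma Rintegral_expN0 (R : realType) (C : R) :
  \int[@lebesgue_measure R]_(s in `]0, +oo[) (C * expR (- s)) = C.
Proof.
rewrite Rintegral_itv_obnd_cbnd; last first.
  exact: integrable_scaled_expN_oo.
rewrite RintegralZl//; last exact: integrable_expN.
by rewrite /Rintegral integral_expN oppr0 expR0 mulr1.
Qed.

Lemma hermite_int_le (R : realType) (P x0 p x : R) :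
  0 <= p -> p <= P -> x0 <= x ->
  hermite_int p x <= expR ((P - 2 * x0 + 1) ^+ 2).
Proof.
move=> p0 pP x0x; rewrite -[leRHS]Rintegral_expN0.
apply: le_Rintegral => //.
- exact: integrable_hkernel.
- exact: integrable_scaled_expN_oo.
- by move=> s; rewrite /= in_itv/= andbT => s0; exact: hkernel_le.
Qed.

Lemma hermite_int_gt0 (R : realType) (p x : R) : 0 <= p -> 0 < hermite_int p x.
Proof.
(* For [s] in [[1, 2]] the power is at least 1 and the exponential at least [c]. *)
move=> p0; pose c := expR (- (4 * `|x|) - 4).
apply: (@lt_le_trans _ _ (c * (2 - 1))); first by rewrite mulr_gt0 ?expR_gt0//; lra.
apply: Rintegral_ge_segment => //.
- exact: integrable_hkernel.
- by move=> s _; exact: hkernel_ge0.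
- by move=> s; rewrite /= !in_itv/= andbT; lra.
- by lra.
- exact: expR_ge0.
move=> s s1 s2; rewrite /hkernel.
have h1 : 1 <= s `^ p by rewrite -[leLHS](powRr0 s) ler_powR.
apply: (@le_trans _ _ (expR (- (2 * x * s) - s ^+ 2))).
  rewrite ler_expR.
  have hx := ler_norm x; have := normr_ge0 x.
  nra.
by rewrite ler_peMl// expR_ge0.
Qed.

Lemma hkernel_at0 (R : realType) (p x : R) : 0 < p -> hkernel p x 0 = 0.
Proof. by move=> p0; rewrite /hkernel powR0 ?mul0r// gt_eqF. Qed.

Lemma hkernel_decay (R : realType) (p x s : R) : 0 < p -> 0 <= s ->
  hkernel p x s <= expR ((p - 2 * x + 1) ^+ 2) * expR (- s).
Proof.
move=> p0; rewrite le_eqVlt => /predU1P[<-|s0].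
  by rewrite hkernel_at0// mulr_ge0// expR_ge0.
by apply: hkernel_le => //; exact: ltW.
Qed.

Lemma hkernel_within (R : realType) (p x : R) : 0 < p ->
  {within `[0, +oo[, continuous (hkernel p x)}.
Proof.
move=> p0; apply: within_continuous_mul; last first.
  apply: continuous_within => s; apply: (@is_derive_continuous _ _ _
    ((- (2 * x) - 2 * s) * expR (- (2 * x * s) - s ^+ 2))).
  by der; ring.
apply/continuous_within_itvcyP; split; last first.
  by rewrite powR0 ?gt_eqF//; exact: powR_cvg0.
move=> s; rewrite in_itv/= andbT => s0.
exact: is_derive_continuous (is_derive1_powR p s0).
Qed.

Lemma integrable_add (R : realType) (D : set R) (f g : R -> R) :
  measurable D -> (@lebesgue_measure R).-integrable D (EFin \o f) ->
  (@lebesgue_measure R).-integrable D (EFin \o g) ->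
  (@lebesgue_measure R).-integrable D (EFin \o (fun x => f x + g x)).
Proof.
move=> mD hf hg.
rewrite (_ : _ \o _ = (fun x => (EFin \o f) x + (EFin \o g) x)%E).
  exact: integrableD.
by apply/funext => x /=; rewrite EFinD.
Qed.

(** Integrates the [s]-derivative of [- 2 * hkernel (p + 1) x s], which vanishes at both ends. As
    differentiation in [x] sends [hermite_int p] to [- 2 * hermite_int (p + 1)], this is the Hermite
    equation [H'' - 2 x H' = 2 (p + 1) H]. *)
Lemma hermite_int_rec (R : realType) (p x : R) : 0 < p ->
  4 * hermite_int (p + 2) x + 4 * x * hermite_int (p + 1) x =
  2 * (p + 1) * hermite_int p x.
Proof.
move=> p0.
pose g s := 4 * hkernel (p + 2) x s + (4 * x * hkernel (p + 1) x s +
            - (2 * (p + 1)) * hkernel p x s).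
pose c q := expR ((q - 2 * x + 1) ^+ 2).
have c0 q : 0 <= c q by exact: expR_ge0.
(* Dominates both [g] and its primitive; the primitive accounts for the extra [2 * c (p + 1)]. *)
pose C := 4 * c (p + 2) + (`|4 * x| + 2) * c (p + 1) + 2 * (p + 1) * c p.
have kb q s : 0 < q -> 0 <= s -> 0 <= hkernel q x s <= c q * expR (- s).
  by move=> q0 s0; rewrite hkernel_ge0 hkernel_decay.
have : \int[@lebesgue_measure R]_(s in `[0, +oo[) g s = - (- 2 * hkernel (p + 1) x 0).
  apply: (@Rintegral_decay _ (fun s => - 2 * hkernel (p + 1) x s) g 0 C).
  - move=> s s0; rewrite /g /hkernel.
    have dp := is_derive1_powR (p + 1) s0.
    have -> : s `^ (p + 2) = s `^ p * s ^+ 2.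
      by rewrite powRD ?powR_mulrn ?(ltW s0)// (gt_eqF s0) implybT.
    have e1 : s `^ (p + 1) = s `^ p * s.
      by rewrite powRD ?powRr1 ?(ltW s0)// (gt_eqF s0) implybT.
    by der; rewrite e1 addrK; ring.
  - by apply: within_continuous_add; [|apply: within_continuous_add]; apply: within_continuous_mul;
      try (by apply: continuous_within => s; exact: cst_continuous);
      apply: hkernel_within; lra.
  - have p1 : 0 < p + 1 by lra.
    have /continuous_within_itvcyP[_ h] := @hkernel_within _ _ x p1.
    by apply: cvgM => //; exact: cvg_cst.
  - move=> s s0.
    have p1 : 0 < p + 1 by lra.
    have /andP[k1 k2] := kb (p + 1) s p1 s0.
    rewrite mulNr normrN ger0_norm; last by lra.
    have e0 := expR_ge0 (- s).
    have := mulr_ge0 (normr_ge0 (4 * x)) (mulr_ge0 (c0 (p + 1)) e0).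
    have := mulr_ge0 (c0 (p + 2)) e0.
    have := mulr_ge0 (ltW p1) (mulr_ge0 (c0 p) e0).
    by rewrite /C; lra.
  - move=> s s0.
    have p1 : 0 < p + 1 by lra.
    have p2 : 0 < p + 2 by lra.
    have /andP[k0 k0'] := kb p s p0 s0.
    have /andP[k1 k1'] := kb (p + 1) s p1 s0.
    have /andP[k2 k2'] := kb (p + 2) s p2 s0.
    have e0 := expR_ge0 (- s).
    have ce := mulr_ge0 (c0 (p + 1)) e0.
    apply: (le_trans (ler_normD _ _)).
    have -> : C * expR (- s) = 4 * (c (p + 2) * expR (- s)) +
       (`|4 * x| * (c (p + 1) * expR (- s)) + 2 * (p + 1) * (c p * expR (- s)))
        + 2 * (c (p + 1) * expR (- s)).
      by rewrite /C; ring.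
    rewrite -addrA; apply: lerD; first by rewrite ger0_norm; lra.
    have := mulr_ge0 (ltW p1) k0.
    have : 2 * (p + 1) * hkernel p x s <= 2 * (p + 1) * (c p * expR (- s)).
      by rewrite ler_wpM2l//; lra.
    have : `|4 * x * hkernel (p + 1) x s| <= `|4 * x| * (c (p + 1) * expR (- s)).
      by rewrite normrM (ger0_norm k1) ler_wpM2l.
    have := ler_normD (4 * x * hkernel (p + 1) x s) (- (2 * (p + 1)) * hkernel p x s).
    rewrite mulNr normrN => h1 h2 h3 h4.
    have h5 : `|2 * (p + 1) * hkernel p x s| = 2 * (p + 1) * hkernel p x s.
      by rewrite ger0_norm; lra.
    by rewrite h5 in h1; lra.
rewrite hkernel_at0 ?mulr0 ?oppr0; last by lra.
have ii q : 0 < q -> forall k : R, (@lebesgue_measure R).-integrable `]0, +oo[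
    (EFin \o (fun s => k * hkernel q x s)).
  move=> q0 k; rewrite (_ : _ \o _ = fun s => (k%:E * (EFin \o hkernel q x) s)%E).
    exact: integrableZl (integrable_hkernel x (ltW q0)).
  by apply/funext => s /=; rewrite EFinM.
have ij q k : 0 < q -> \int[@lebesgue_measure R]_(s in `]0, +oo[)
    (k * hkernel q x s) = k * hermite_int q x.
  by move=> q0; rewrite RintegralZl//; exact: integrable_hkernel (ltW q0).
have p1 : 0 < p + 1 by lra.
have p2 : 0 < p + 2 by lra.
have iB : (@lebesgue_measure R).-integrable `]0, +oo[ (EFin \o (fun s =>
    4 * x * hkernel (p + 1) x s + - (2 * (p + 1)) * hkernel p x s)).
  by apply: integrable_add => //; exact: ii.
have iA : (@lebesgue_measure R).-integrable `]0, +oo[ (EFin \o g).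
  by apply: integrable_add => //; exact: ii.
rewrite -Rintegral_itv_obnd_cbnd// RintegralD//; last exact: ii.
by rewrite RintegralD ?ij//; [lra|exact: ii|exact: ii].
Qed.

(** * Decaying solutions of the Weber equation *)

(** All exponential rates [m] are required, so that the class is stable under multiplication by
    polynomials in [x], which the creation operator introduces. Uniformity in [l] provides the
    domination behind continuity in [l]. *)
Definition rapid (R : realType) (L : R) (g : R -> R -> R) : Prop :=
  forall a b x0 m : R, b < L -> exists2 C, 0 <= C & forall l x : R,
    a <= l -> l <= b -> x0 <= x -> `|g l x| <= C * expR (- (m * x)).

(** Here [E] is the [x]-derivative of [D]. The normalization of [D l] is left free: signs are always
    compared through products such as [D l x * D k x], or through ratios. *)
Definition weber_family (R : realType) (L : R) (D E : R -> R -> R) : Prop :=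
  [/\ forall l x : R, l < L -> is_derive x 1 (D l) (E l x),
      forall l x : R, l < L -> is_derive x 1 (E l) ((x ^+ 2 - l) * D l x),
      forall l x : R, l < L ->
        {for l, continuous (fun k => D k x)} /\
        {for l, continuous (fun k => E k x)},
      rapid L D /\ rapid L E &
      forall l x : R, l < L -> ~ (D l x = 0 /\ E l x = 0)].

Lemma rapidD (R : realType) (L : R) (f g : R -> R -> R) :
  rapid L f -> rapid L g -> rapid L (fun l x => f l x + g l x).
Proof.
move=> hf hg a b x0 m bL.
have [C C0 hC] := hf a b x0 m bL; have [B B0 hB] := hg a b x0 m bL.
exists (C + B); first exact: addr_ge0.
move=> l x al lb x0x; rewrite mulrDl; apply: (le_trans (ler_normD _ _)).
by apply: lerD; [exact: hC|exact: hB].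
Qed.

Lemma rapidN (R : realType) (L : R) (f : R -> R -> R) :
  rapid L f -> rapid L (fun l x => - f l x).
Proof.
move=> hf a b x0 m bL; have [C C0 hC] := hf a b x0 m bL.
by exists C => // l x al lb x0x; rewrite normrN; exact: hC.
Qed.

Lemma norm_le_expR (R : realType) (x0 x : R) : x0 <= x ->
  `|x| <= (1 + `|x0| * expR (- x0)) * expR x.
Proof.
move=> x0x; have [x_ge0|x_lt0] := leP 0 x.
  have : 0 <= `|x0| * expR (- x0) * expR x by rewrite !mulr_ge0// expR_ge0.
  by rewrite (ger0_norm x_ge0) mulrDl mul1r; have := expR_ge1Dx x; lra.
rewrite ltr0_norm// ltr0_norm ?(le_lt_trans x0x)//.
have h : 1 <= expR (- x0) * expR x by rewrite -expRD -expR0 ler_expR; lra.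
have : - x <= - x0 * (expR (- x0) * expR x).
  by rewrite (@le_trans _ _ (- x0))//; [lra|rewrite ler_peMr//; lra].
by have := expR_ge0 x; lra.
Qed.

(** The factor [x] costs one unit of rate: the bound on [f] is taken at [m + 1], and [expR x]
    absorbs [|x|]. *)
Lemma rapid_mulx (R : realType) (L : R) (f : R -> R -> R) :
  rapid L f -> rapid L (fun l x => x * f l x).
Proof.
move=> hf a b x0 m bL; have [C C0 hC] := hf a b x0 (m + 1) bL.
pose B := 1 + `|x0| * expR (- x0).
have B0 : 0 <= B by rewrite addr_ge0// mulr_ge0// expR_ge0.
exists (B * C); first exact: mulr_ge0.
move=> l x al lb x0x; rewrite normrM.
have -> : B * C * expR (- (m * x)) = (B * expR x) * (C * expR (- ((m + 1) * x))).
  rewrite mulrACA -expRD; congr (_ * expR _); ring.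
by apply: ler_pM => //; [exact: norm_le_expR|exact: hC].
Qed.

Lemma rapid_mull (R : realType) (L : R) (f : R -> R -> R) :
  rapid L f -> rapid L (fun l x => l * f l x).
Proof.
move=> hf a b x0 m bL; have [C C0 hC] := hf a b x0 m bL.
exists ((`|a| + `|b|) * C); first by rewrite mulr_ge0// addr_ge0.
move=> l x al lb x0x; rewrite normrM -mulrA; apply: ler_pM => //; last exact: hC.
rewrite ler_norml; have := ler_norm b; have := ler_norm (- a).
by rewrite normrN; have := normr_ge0 a; have := normr_ge0 b; lra.
Qed.

Lemma rapidZ (R : realType) (L c : R) (f : R -> R -> R) :
  rapid L f -> rapid L (fun l x => c * f l x).
Proof.
move=> hf a b x0 m bL; have [C C0 hC] := hf a b x0 m bL.
exists (`|c| * C); first exact: mulr_ge0.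
by move=> l x al lb x0x; rewrite normrM -mulrA ler_wpM2l// hC.
Qed.

Lemma rapid_poly (R : realType) (L : R) (p : {poly R}) (f : R -> R -> R) :
  rapid L f -> rapid L (fun l x => p.[x] * f l x).
Proof.
move=> hf; elim/poly_ind: p => [|p c IH].
  by have := rapidZ 0 hf; congr rapid; apply/funext => l; apply/funext => x;
    rewrite horner0.
have := rapidD (rapid_mulx IH) (rapidZ c hf); congr rapid.
by apply/funext => l; apply/funext => x; rewrite hornerMXaddC; ring.
Qed.

Lemma rapid_shift (R : realType) (L : R) (f : R -> R -> R) :
  rapid L f -> rapid (L + 2) (fun l x => f (l - 2) x).
Proof.
move=> hf a b x0 m bL.
have bL' : b - 2 < L by lra.
have [C C0 hC] := hf (a - 2) (b - 2) x0 m bL'.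
by exists C => // l x al lb x0x; apply: hC => //; lra.
Qed.

Lemma expN_sqr_le (R : realType) (m x : R) :
  expR (- (x ^+ 2 / 2)) <= expR (m ^+ 2 / 2) * expR (- (m * x)).
Proof.
rewrite -expRD ler_expR; have := sqr_ge0 (x - m); rewrite !expr2; lra.
Qed.

Local Opaque hermite_int.

(** A parabolic cylinder function: [expR (- (x ^+ 2 / 2))] times the Hermite function of order
    [(l - 1) / 2], up to a Gamma factor. The exponent of the kernel is positive exactly when
    [l < -1]. *)
Definition weber_base (R : realType) (l x : R) : R :=
  expR (- (x ^+ 2 / 2)) * hermite_int (- (l + 1) / 2) x.

Definition weber_base' (R : realType) (l x : R) : R :=
  - x * weber_base l x
  - 2 * expR (- (x ^+ 2 / 2)) * hermite_int (- (l + 1) / 2 + 1) x.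

Lemma rapid_hermite (R : realType) (k : R) : 0 <= k ->
  rapid (-1) (fun l x : R =>
    expR (- (x ^+ 2 / 2)) * hermite_int (- (l + 1) / 2 + k) x).
Proof.
move=> k0 a b x0 m b1; pose P := - (a + 1) / 2 + k.
exists (expR (m ^+ 2 / 2) * expR ((P - 2 * x0 + 1) ^+ 2)).
  by rewrite mulr_ge0// expR_ge0.
move=> l x al lb x0x; have q0 : 0 <= - (l + 1) / 2 + k by lra.
have f0 := ltW (hermite_int_gt0 x q0).
rewrite ger0_norm; last by rewrite mulr_ge0// expR_ge0.
have f1 : hermite_int (- (l + 1) / 2 + k) x <= expR ((P - 2 * x0 + 1) ^+ 2).
  by apply: hermite_int_le => //; rewrite /P; lra.
apply: (@le_trans _ _ (expR (m ^+ 2 / 2) * expR (- (m * x)) *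
                       expR ((P - 2 * x0 + 1) ^+ 2))).
  exact: (ler_pM (expR_ge0 _) f0 (expN_sqr_le m x) f1).
by rewrite -!mulrA ler_pM2l ?expR_gt0// mulrC.
Qed.

Lemma weber_family_base (R : realType) :
  weber_family (-1) (@weber_base R) (@weber_base' R).
Proof.
have rD : rapid (-1) (@weber_base R).
  have := @rapid_hermite R 0 (lexx _).
  rewrite (_ : (fun l x : R => _) = @weber_base R)//.
  by apply/funext => l; apply/funext => x; rewrite addr0.
split.
- move=> l x l1; have q0 : 0 < - (l + 1) / 2 by lra.
  have d := is_derive_hermite_int x q0.
  by rewrite /weber_base' /weber_base; der; field.
- move=> l x l1; have q0 : 0 < - (l + 1) / 2 by lra.
  have q1 : 0 < - (l + 1) / 2 + 1 by lra.
  have d := is_derive_hermite_int x q0.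
  have d1 := is_derive_hermite_int x q1.
  have e := hermite_int_rec x q0.
  rewrite /weber_base' /weber_base; der.
  have e2 : hermite_int (- (l + 1) / 2 + 1 + 1) x =
      (1 - l) / 4 * hermite_int (- (l + 1) / 2) x
      - x * hermite_int (- (l + 1) / 2 + 1) x.
    have -> : - (l + 1) / 2 + 1 + 1 = - (l + 1) / 2 + 2 by ring.
    by clear -e; lra.
  by rewrite e2; field.
- move=> l x l1; have q0 : 0 < - (l + 1) / 2 by lra.
  have q1 : 0 < - (l + 1) / 2 + 1 by lra.
  have c k : 0 < - (l + 1) / 2 + k ->
      {for l, continuous (fun l : R => hermite_int (- (l + 1) / 2 + k) x)}.
    move=> qk; apply: (@continuous_comp _ _ _ (fun l : R => - (l + 1) / 2 + k)
      (fun q => hermite_int q x)); last exact: hermite_int_continuous_exponent.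
    by apply: (@is_derive_continuous _ _ _ (- 1 / 2)); der; ring.
  have cD : {for l, continuous (fun k => weber_base k x)}.
    apply: continuousM; first exact: cst_continuous.
    have := c 0; rewrite addr0 => /(_ q0).
    by rewrite (_ : (fun _ => _) = fun l : R => hermite_int (- (l + 1) / 2) x)//;
      apply/funext => k; rewrite addr0.
  split => //; apply: continuousB; apply: continuousM => //;
    [exact: cst_continuous|exact: cst_continuous|exact: c].
- split => //; apply: rapidD.
    have := rapidN (rapid_mulx rD).
    rewrite (_ : (fun l x : R => _) = fun l x => - x * weber_base l x)//.
    by apply/funext => l; apply/funext => x; rewrite mulNr.
  have h := rapidN (@rapid_hermite R 1 ler01).
  have := rapidD h h.
  rewrite (_ : (fun l x : R => _) = fun l x => - (2 * expR (- (x ^+ 2 / 2)) *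
    hermite_int (- (l + 1) / 2 + 1) x))//.
  by apply/funext => l; apply/funext => x; ring.
(* At this level [D] itself is positive, being the integral of a positive kernel. *)
- move=> l x l1 [h _]; have q0 : 0 <= - (l + 1) / 2 by lra.
  have := hermite_int_gt0 x q0.
  by move: h => /eqP; rewrite mulf_eq0 gt_eqF ?expR_gt0//= => /eqP ->; rewrite ltxx.
Qed.

Lemma weber_familyW (R : realType) (L M : R) (D E : R -> R -> R) :
  M <= L -> weber_family L D E -> weber_family M D E.
Proof.
move=> ML [hD hE hc [rD rE] h0].
split; [| | |split|];
  try by move=> l x lM; (apply: hD || apply: hE || apply: hc || apply: h0); lra.
- by move=> a b x0 m bM; apply: rD; lra.
- by move=> a b x0 m bM; apply: rE; lra.
Qed.

(* The creation operator [x - d/dx]; it only kills [exp (x^2 / 2)], which does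
   not decay. *)
Lemma weber_family_raise (R : realType) (L : R) (D E : R -> R -> R) :
  weber_family L D E ->
  weber_family (L + 2) (fun l x => x * D (l - 2) x - E (l - 2) x)
    (fun l x => D (l - 2) x + x * E (l - 2) x - (x ^+ 2 - (l - 2)) * D (l - 2) x).
Proof.
move=> [hD hE hc [rD rE] h0]; split.
- move=> l x lL; have l2 : l - 2 < L by lra.
  have dD := hD _ x l2; have dE := hE _ x l2.
  by der; ring.
- move=> l x lL; have l2 : l - 2 < L by lra.
  have dD := hD _ x l2; have dE := hE _ x l2.
  by der; ring.
- move=> l x lL; have l2 : l - 2 < L by lra.
  have [cD cE] := hc _ x l2.
  have cs : {for l, continuous (fun l : R => l - 2)}.
    by apply: (@is_derive_continuous _ _ _ 1); der; ring.
  have cD' : {for l, continuous (fun k : R => D (k - 2) x)}.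
    exact: (@continuous_comp _ _ _ (fun k : R => k - 2) (fun k => D k x)).
  have cE' : {for l, continuous (fun k : R => E (k - 2) x)}.
    exact: (@continuous_comp _ _ _ (fun k : R => k - 2) (fun k => E k x)).
  split.
    by apply: continuousB => //; apply: continuousM => //; exact: cst_continuous.
  apply: continuousB.
    by apply: continuousD => //; apply: continuousM => //; exact: cst_continuous.
  apply: continuousM => //; apply: continuousB => //; exact: cst_continuous.
- have sD := rapid_shift rD; have sE := rapid_shift rE.
  split; first exact: rapidD (rapid_mulx sD) (rapidN sE).
  apply: rapidD; first exact: rapidD sD (rapid_mulx sE).
  have := rapidD (rapidN (rapid_mulx (rapid_mulx sD)))
                 (rapidD (rapid_mull sD) (rapidD (rapidN sD) (rapidN sD))).
  rewrite (_ : (fun l x : R => _) = fun l x =>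
    - ((x ^+ 2 - (l - 2)) * D (l - 2) x))//.
  by apply/funext => l; apply/funext => x; ring.
- move=> l x lL; have l2 : l - 2 < L by lra.
  move=> [e1 e2].
  have {}e1 : E (l - 2) x = x * D (l - 2) x by lra.
  (* Once [E = x D], the raised derivative reduces to [(l - 1) D], so the only level at which
     nondegeneracy could fail is [l = 1]. *)
  have h1 : (l - 1) * D (l - 2) x = 0 by move: e2; rewrite e1 => <-; ring.
  move/eqP: h1; rewrite mulf_eq0 => /orP[|]/eqP h1; last first.
    by apply: (h0 _ x l2); rewrite h1 e1 h1 mulr0.
  have {h1}lE : l = 1 by lra.
  rewrite lE in l2 e1 *.
  have dD y := hD _ y l2; have dE y := hE _ y l2.
  set d := D (1 - 2) in dD dE e1 *; set e := E (1 - 2) in dD dE e1 *.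
  (* For [l = 1] the equation below is [d'' = (z^2 + 1) d], which factors: [w = e - z d] satisfies
     [w' = - z w]. Hence [w], zero at [x], vanishes to the right of [x], and there [d' = y d]. *)
  have dW y : is_derive y (1 : R)
      (fun z => (e z - z * d z) * expR (z ^+ 2 / 2)) 0 by der; field.
  have w0 y : x <= y -> e y = y * d y.
    move=> xy; have cW : {within `[x, y], continuous
      (fun z => (e z - z * d z) * expR (z ^+ 2 / 2))}.
      by apply: continuous_within => z; exact: is_derive_continuous (dW z).
    have := derivative0_eq xy cW (fun z _ _ => dW z).
    rewrite e1 subrr mul0r => /esym/eqP; rewrite mulf_eq0.
    by rewrite (gt_eqF (expR_gt0 _)) orbF => /eqP; lra.
  have dV y : is_derive y (1 : R) (fun z => d z * expR (- (z ^+ 2 / 2)))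
      ((e y - y * d y) * expR (- (y ^+ 2 / 2))) by der; field.
  have v0 y : x <= y -> d x * expR (- (x ^+ 2 / 2)) = d y * expR (- (y ^+ 2 / 2)).
    move=> xy.
    apply: (@derivative0_eq _ (fun z => d z * expR (- (z ^+ 2 / 2))) x y xy).
      by apply: continuous_within => z; exact: is_derive_continuous (dV z).
    by move=> z xz _; have := dV z; rewrite (w0 z (ltW xz)) subrr mul0r.
  have [C C0 hC] := rD (1 - 2) (1 - 2) x 1 l2.
  (* So [d] is a multiple of [expR (y ^+ 2 / 2)] on this half-line, and decay forces the multiple to
     be 0. *)
  have dx0 : d x * expR (- (x ^+ 2 / 2)) = 0.
    apply: (@cst_decay_eq0 _ (fun y => d y * expR (- (y ^+ 2 / 2))) x C) => // y xy.
    rewrite normrM (ger0_norm (expR_ge0 _)).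
    have := hC _ _ (lexx _) (lexx _) xy; rewrite mul1r -/d => h.
    apply: (le_trans _ h); rewrite ler_piMr// expR_le1.
    by have := sqr_ge0 y; lra.
  apply: (h0 _ x l2); rewrite -/d -/e e1.
  move/eqP: dx0; rewrite mulf_eq0 (gt_eqF (expR_gt0 _)) orbF => /eqP ->.
  by rewrite mulr0.
Qed.

Lemma exists_weber_family (R : realType) (L : R) :
  exists D E, weber_family L D E.
Proof.
suff h n : exists D E, weber_family (- 1 + (2 * n)%:R : R) D E.
  have [D [E h']] := h (Num.bound `|L + 1|); exists D, E; apply: weber_familyW h'.
  have := archi_boundP (normr_ge0 (L + 1)); have := ler_norm (L + 1).
  by rewrite natrM; have := normr_ge0 (L + 1); lra.
elim: n => [|n [D [E h]]].
  exists (@weber_base R), (@weber_base' R); rewrite muln0 addr0; exact: weber_family_base.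
have := weber_family_raise h.
rewrite (_ : - 1 + (2 * n)%:R + 2 = - 1 + (2 * n.+1)%:R :> R); first by eauto.
by rewrite mulnS natrD; ring.
Qed.

(** * Sign changes *)

Lemma IVT_sign (R : realType) (f : R -> R) (a b : R) :
  a < b -> {within `[a, b], continuous f} -> f a * f b < 0 ->
  exists2 c, a < c < b & f c = 0.
Proof.
move=> ab cf fab.
have [|c] := @IVT R f a b 0 (ltW ab) cf.
  rewrite ge_min le_max; have [fa|fa] := leP (f a) 0 => /=.
    by apply/orP; right; nra.
  by apply/andP; split; [nra|apply/orP; left; exact: ltW].
rewrite in_itv/= => /andP[ac cb] fc0; exists c => //.
have fa0 : f a != 0 by apply: contraTneq fab => ->; rewrite mul0r ltxx.
have fb0 : f b != 0 by apply: contraTneq fab => ->; rewrite mulr0 ltxx.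
rewrite !lt_neqAle ac cb !andbT; apply/andP; split.
  by apply: contraNneq fa0 => ->; rewrite fc0.
by apply: contraNneq fb0 => <-; rewrite fc0.
Qed.

(** Replaces a positive derivative when only the sign of increments at each point is known, as for
    functions of the spectral parameter. The supremum of the good initial segments is itself good,
    and local increase carries it further unless it is [b]. *)
Lemma locally_increasing_lt (R : realType) (f : R -> R) (a b : R) : a < b ->
  (forall x, a <= x -> x <= b -> exists2 d, 0 < d & forall y, a <= y -> y <= b ->
     `|y - x| < d -> y != x -> 0 < (y - x) * (f y - f x)) ->
  f a < f b.
Proof.
move=> ab h.
pose S := [set y | a <= y <= b /\ forall z, a < z -> z <= y -> f a < f z].
have Sa : S a by split; [rewrite lexx ltW|move=> z az za; lra].
have ubS : ubound S b by move=> y [/andP[]].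
have hS : has_sup S by split; [exists a|exists b].
pose s := sup S.
have as_ : a <= s by apply: ub_le_sup => //; exists b.
have sb : s <= b by apply: ge_sup => //; exists a.
have lt_s z : a < z -> z < s -> f a < f z.
  move=> az zs; have sz : 0 < s - z by rewrite subr_gt0.
  have [y [_ Sy] zy] := sup_adherent sz hS.
  by apply: Sy => //; rewrite opprB addrCA subrr addr0 in zy; exact: ltW.
have [d d0 hd] := h s as_ sb.
have fs : a < s -> f a < f s.
  move=> lt_as; pose z := Num.max (s - d / 2) ((a + s) / 2).
  have zs : z < s by rewrite gt_max; lra.
  have z1 : s - d / 2 <= z by rewrite le_max lexx.
  have z2 : (a + s) / 2 <= z by rewrite le_max lexx orbT.
  have faz : f a < f z by apply: lt_s => //; lra.
  have zd : `|z - s| < d by rewrite ltr0_norm; lra.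
  have := hd z ltac:(lra) ltac:(lra) zd (negbT (lt_eqF zs)).
  by nra.
have [s_lt|] := ltP s b; last by move=> bs; have -> : b = s by [lra|]; apply: fs; lra.
pose y := Num.min (s + d / 2) b.
have sy : s < y by rewrite lt_min s_lt andbT; lra.
have yb : y <= b by rewrite ge_min lexx orbT.
have yd : y <= s + d / 2 by rewrite ge_min lexx.
have Sy : S y.
  split; first by rewrite yb andbT; lra.
  move=> z az zy; have [zs|sz] := ltP z s; first exact: lt_s.
  have [zs|zs] := eqVneq z s; first by rewrite zs; apply: fs; rewrite -zs.
  have zd : `|z - s| < d by rewrite ger0_norm; lra.
  have := hd z (ltW az) (le_trans zy yb) zd zs.
  have lt_sz : s < z by rewrite lt_neqAle eq_sym zs sz.
  have : f a <= f s.
    by move: as_; rewrite le_eqVlt => /predU1P[->//|/fs/ltW].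
  by nra.
have : y <= s by apply: ub_le_sup => //; exists b.
lra.
Qed.

(** Otherwise [x] would be an interior maximum. The side on which [f] is positive depends on the
    sign of [d] and is left open. *)
Lemma derivative_neq0_gt0 (R : realType) (f : R -> R) (x d e : R) :
  0 < e -> (forall y, derivable f y 1) -> is_derive x (1 : R) f d -> d != 0 ->
  f x = 0 -> exists2 y, `|y - x| < e & 0 < f y.
Proof.
move=> e0 df dx d0 fx; apply: contrapT => h.
have xe : x \in `](x - e), (x + e)[ by rewrite in_itv/=; lra.
have := @derive1_at_max R f (x - e) (x + e) x ltac:(lra) (fun y _ => df y) xe.
case.
  move=> t; rewrite in_itv/= => /andP[t1 t2]; rewrite fx leNgt; apply/negP => ft.
  by apply: h; exists t => //; rewrite ltr_norml; lra.
move=> _ e1; have e2 : d = 0 by rewrite -e1; exact/esym/derive_val.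
by rewrite e2 eqxx in d0.
Qed.

Lemma Rintegral_gt0 (R : realType) (f : R -> R) (a y : R) :
  (forall x, {for x, continuous f}) -> (forall x, 0 <= f x) ->
  (@lebesgue_measure R).-integrable `[a, +oo[ (EFin \o f) ->
  a <= y -> 0 < f y -> 0 < \int[@lebesgue_measure R]_(x in `[a, +oo[) f x.
Proof.
move=> cf f0 fi ay fy.
have fy2 : 0 < f y / 2 by lra.
have [d d0 hd] : exists2 d, 0 < d & forall z, `|y - z| < d -> f y / 2 < f z.
  have /cvgrPdist_lt/(_ _ fy2)[d /= d0 hd] := cf y.
  exists d => // z yz; have := hd z yz; rewrite ltr_norml => /andP[]; lra.
apply: (@lt_le_trans _ _ (f y / 2 * (y + d / 2 - y))).
  by rewrite mulr_gt0//; lra.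
apply: Rintegral_ge_segment => //.
- by move=> x; rewrite /= !in_itv/= andbT; lra.
- by lra.
- exact: ltW.
by move=> x yx xb; apply/ltW/hd; rewrite ler0_norm; lra.
Qed.

(** * Zeros of the boundary condition *)

Lemma rapid_mul_decay (R : realType) (L : R) (f g : R -> R -> R) (a b x0 : R) :
  rapid L f -> rapid L g -> b < L ->
  exists2 C, 0 <= C & forall l k y : R, a <= l -> l <= b -> a <= k -> k <= b ->
    x0 <= y -> `|f l y * g k y| <= C * expR (- y).
Proof.
move=> hf hg bL; have [C C0 hC] := hf a b x0 (1 / 2) bL.
have [B B0 hB] := hg a b x0 (1 / 2) bL.
exists (C * B); first exact: mulr_ge0.
move=> l k y al lb ak kb x0y; rewrite normrM.
have -> : C * B * expR (- y) =
    (C * expR (- (1 / 2 * y))) * (B * expR (- (1 / 2 * y))).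
  by rewrite mulrACA -expRD; congr (_ * expR _); field.
by apply: ler_pM => //; [exact: hC|exact: hB].
Qed.

Lemma rapid_mul_decay2 (R : realType) (L : R) (f g : R -> R -> R) (l k x0 : R) :
  rapid L f -> rapid L g -> l < L -> k < L ->
  exists2 C, 0 <= C & forall y, x0 <= y -> `|f l y * g k y| <= C * expR (- y).
Proof.
move=> hf hg lL kL.
have mL : Num.max l k < L by rewrite gt_max lL.
have [C C0 hC] := rapid_mul_decay (Num.min l k) x0 hf hg mL.
exists C => // y x0y.
by apply: hC; rewrite // ?ge_min ?le_max lexx ?orbT.
Qed.

Section spectral_function.
Context (R : realType) (L : R) (D E : R -> R -> R) (hDE : weber_family L D E).

Lemma weber_continuous (l x : R) : l < L ->
  {for x, continuous (D l)} /\ {for x, continuous (E l)}.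
Proof.
have [hD hE _ _ _] := hDE.
by move=> lL; split; [exact: is_derive_continuous (hD l x lL)|
                      exact: is_derive_continuous (hE l x lL)].
Qed.

Lemma weber_mul_continuous (l k x : R) : l < L -> k < L ->
  {for x, continuous (fun y => D l y * D k y)}.
Proof.
move=> lL kL.
exact: continuousM (weber_continuous x lL).1 (weber_continuous x kL).1.
Qed.

Lemma weber_mul_integrable (l k x : R) : l < L -> k < L ->
  (@lebesgue_measure R).-integrable `[x, +oo[ (EFin \o (fun y => D l y * D k y)).
Proof.
have [_ _ _ [rD _] _] := hDE.
move=> lL kL; have [C C0 hC] := rapid_mul_decay2 x rD rD lL kL.
apply: integrable_decay hC; apply: continuous_measurable_on => // y.
exact: weber_mul_continuous.
Qed.

(** Lagrange's identity, with decay removing the term at infinity. For [k] near [l] the integral is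
    near a positive squared norm, so the left side has the sign of [k - l]; this stands in for a
    derivative in [l]. *)
Lemma wronskian (l k x : R) : l < L -> k < L ->
  D l x * E k x - E l x * D k x =
  (k - l) * \int[@lebesgue_measure R]_(y in `[x, +oo[) (D l y * D k y).
Proof.
have [hD hE _ [rD rE] _] := hDE.
move=> lL kL.
have dW y : is_derive y (1 : R) (fun z => D l z * E k z - E l z * D k z)
    ((l - k) * (D l y * D k y)).
  have d1 := hD l y lL; have d2 := hD k y kL.
  have d3 := hE l y lL; have d4 := hE k y kL.
  by der; ring.
have [C1 C10 hC1] := rapid_mul_decay2 x rD rE lL kL.
have [C2 C20 hC2] := rapid_mul_decay2 x rE rD lL kL.
have [C3 C30 hC3] := rapid_mul_decay2 x rD rD lL kL.
pose C := C1 + C2 + `|l - k| * C3.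
have := @Rintegral_decay _ _ (fun y => (l - k) * (D l y * D k y)) x C
  (fun y _ => dW y).
rewrite RintegralZl//; last exact: weber_mul_integrable.
move=> h; rewrite -[LHS]opprK -h; first by ring.
- apply: continuous_within => y; apply: continuousM; first exact: cst_continuous.
  exact: weber_mul_continuous.
- apply: cvg_at_right_filter; exact: is_derive_continuous (dW x).
- move=> y xy; rewrite (le_trans (ler_normB _ _))//.
  have := hC1 y xy; have := hC2 y xy; have := expR_ge0 (- y) => e0.
  have := mulr_ge0 (mulr_ge0 (normr_ge0 (l - k)) C30) e0.
  by rewrite /C; lra.
- move=> y xy; rewrite normrM.
  have := hC3 y xy; have := expR_ge0 (- y) => e0 h3.
  have : `|l - k| * `|D l y * D k y| <= `|l - k| * (C3 * expR (- y)).
    by rewrite ler_wpM2l.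
  have := mulr_ge0 C10 e0; have := mulr_ge0 C20 e0.
  by rewrite /C; lra.
Qed.

Lemma weber_neq0_right (l x : R) : l < L -> exists2 y, x <= y & D l y != 0.
Proof.
have [hD _ _ _ h0] := hDE.
move=> lL; apply: contrapT => h.
have h' y : x <= y -> D l y = 0.
  by move=> xy; apply: contrapT => yn; apply: h; exists y => //; apply/eqP.
have x1 : x < x + 1 by lra.
have cD : {within `[x, x + 1], continuous (D l)}.
  by apply: continuous_within => y; exact: (weber_continuous y lL).1.
have [c] := MVT x1 (fun y _ => hD l y lL) cD.
rewrite in_itv/= => /andP[xc _]; rewrite !h'; [|lra|lra].
by rewrite subrr => e; apply: (h0 l c lL); split; [apply: h'; lra|lra].
Qed.

Lemma weber_norm_gt0 (l x : R) : l < L ->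
  0 < \int[@lebesgue_measure R]_(y in `[x, +oo[) (D l y * D l y).
Proof.
move=> lL; have [y xy yn] := weber_neq0_right x lL.
apply: (@Rintegral_gt0 _ _ _ y) => //.
- by move=> z; exact: weber_mul_continuous.
- by move=> z; rewrite -expr2 sqr_ge0.
- exact: weber_mul_integrable.
- by rewrite -expr2 exprn_even_gt0.
Qed.

Lemma weber_inner_continuous (l x : R) : l < L ->
  {for l, continuous (fun k =>
    \int[@lebesgue_measure R]_(y in `[x, +oo[) (D l y * D k y))}.
Proof.
have [_ _ hc [rD _] _] := hDE.
(* The uniform bounds hold on parameter intervals ending strictly below [L], hence the midpoint. *)
move=> lL; pose b := (l + L) / 2.
have bL : b < L by rewrite /b; lra.
have [C C0 hC] := rapid_mul_decay (l - 1) x rD rD bL.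
have Il : l \in `]l - 1, b[%classic by rewrite inE/= in_itv/= /b; lra.
apply: (@continuity_under_integral R _ _ (@lebesgue_measure R)
  (fun k y => D l y * D k y) _ (measurable_itv `[x, +oo[) _ _ _ _ _
  (integrable_scaled_expN C x) _ _ Il).
- move=> k; rewrite /= in_itv/= => /andP[_ kb].
  by apply: weber_mul_integrable => //; lra.
- apply/aeW => y _ k; rewrite inE/= in_itv/= => /andP[_ kb].
  apply: continuousM; first exact: cst_continuous.
  by apply: (hc k y _).1; lra.
- move=> k; rewrite /= in_itv/= => /andP[lk kb].
  apply/aeW => y; rewrite /= in_itv/= andbT => xy.
  by apply: hC => //; rewrite ?ltW//; rewrite /b; lra.
Qed.

Lemma weber_inner_gt0_near (l x : R) : l < L ->
  exists2 d, 0 < d & forall k : R, `|k - l| < d -> k < L /\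
    0 < \int[@lebesgue_measure R]_(y in `[x, +oo[) (D l y * D k y).
Proof.
move=> lL; have n0 := weber_norm_gt0 x lL.
have /cvgrPdist_lt/(_ _ n0)[d /= d0 hd] := @weber_inner_continuous l x lL.
exists (Num.min d (L - l)).
  by rewrite lt_min d0 subr_gt0.
move=> k; rewrite lt_min => /andP[kd kL].
split; first by have := ler_norm (k - l); lra.
have := hd k; rewrite /= distrC => /(_ kd); rewrite ltr_norml => /andP[_]; lra.
Qed.

Lemma weber_at_zero (l x g : R) : l < L -> E l x - g * D l x = 0 -> D l x != 0.
Proof.
have [_ _ _ _ h0] := hDE.
move=> lL e; apply/eqP => d; apply: (h0 l x lL); split => //.
by move: e; rewrite d mulr0 subr0.
Qed.

(** Substituting [E l x = g * D l x] turns the product into the Wronskian of [D l] and [D k]. The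
    zero is thus simple, and the factor [D l x] normalizes the crossing to be upward. *)
Lemma weber_sign_near (l x g : R) : l < L -> E l x - g * D l x = 0 ->
  exists2 d, 0 < d & forall k : R, `|k - l| < d -> k < L /\
    (k != l -> 0 < (k - l) * (D l x * (E k x - g * D k x))).
Proof.
move=> lL e; have [d d0 hd] := weber_inner_gt0_near x lL.
exists d => // k kd; have [kL J0] := hd k kd; split => // kl.
have -> : D l x * (E k x - g * D k x) = D l x * E k x - E l x * D k x.
  by have -> : E l x = g * D l x; [lra|ring].
rewrite wronskian// mulrA mulr_gt0// -expr2.
by rewrite exprn_even_gt0//= subr_eq0.
Qed.

Lemma boundary_continuous (l x g : R) : l < L ->
  {for l, continuous (fun k => E k x - g * D k x)}.
Proof.
have [_ _ hc _ _] := hDE.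
move=> lL; have [cD cE] := hc l x lL.
by apply: continuousB => //; apply: continuousM => //; exact: cst_continuous.
Qed.

Lemma continuous_neq0_sign (f : R -> R) (x : R) : {for x, continuous f} ->
  f x != 0 -> exists2 d, 0 < d & forall y, `|y - x| < d -> 0 < f x * f y.
Proof.
move=> cf fx; have f0 : 0 < `|f x| by rewrite normr_gt0.
have /cvgrPdist_lt/(_ _ f0)[d /= d0 hd] := cf.
exists d => // y yd; have := hd y; rewrite /= distrC => /(_ yd).
rewrite ltr_norml; move: fx; rewrite neq_lt => /orP[fx|fx].
  by rewrite (ltr0_norm fx) => /andP[h1 h2]; rewrite nmulr_rgt0//; lra.
by rewrite (gtr0_norm fx) => /andP[h1 h2]; rewrite pmulr_rgt0//; lra.
Qed.

(** A Moebius image of the Weyl function [E / D]. Its increments are [g' - g] times a Wronskian over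
    the product of the two denominators; that product is positive for nearby parameters, since the
    denominator does not vanish on [[a, b]]. *)
Lemma boundary_ratio_increasing (g g' a b x : R) : g < g' -> a < b -> b < L ->
  (forall l, a <= l -> l <= b -> E l x - g * D l x != 0) ->
  (E a x - g' * D a x) / (E a x - g * D a x) <
  (E b x - g' * D b x) / (E b x - g * D b x).
Proof.
move=> gg' ab bL h.
pose G l := E l x - g * D l x; pose G' l := E l x - g' * D l x.
apply: (@locally_increasing_lt _ (fun l => G' l / G l)) => // l al lb.
have lL : l < L by lra.
have Gl : G l != 0 by exact: h.
have [d d0 hd] := weber_inner_gt0_near x lL.
have [e e0 he] := continuous_neq0_sign (@boundary_continuous l x g lL) Gl.
exists (Num.min d e); first by rewrite lt_min d0.
move=> k ak kb; rewrite lt_min => /andP[kd ke] kl.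
have [kL J0] := hd k kd.
have GG : 0 < G l * G k by exact: he.
have Gk : G k != 0 by exact: h.
have -> : G' k / G k - G' l / G l = (g' - g) *
    (D l x * E k x - E l x * D k x) / (G l * G k).
  rewrite /G' /G in Gk Gl *; field.
  by rewrite Gk Gl.
rewrite wronskian//.
have -> (A B : R) : (k - l) * ((g' - g) * ((k - l) * A) / B) =
  (k - l) ^+ 2 * (g' - g) * A / B by ring.
rewrite divr_gt0// mulr_gt0// mulr_gt0 ?subr_gt0//.
by rewrite exprn_even_gt0//= subr_eq0.
Qed.

(** With [l = - k^2], the quantity [(E + k D) D] has derivative [x^2 D^2 + (E + k D)^2] and tends to
    0. For [k > 0] it bounds [E / D] by [- k], so that [E / D] tends to [-oo] as [l] does. *)
Lemma weber_low (l k x : R) : l < L -> k ^+ 2 = - l ->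
  D l x * E l x + k * D l x ^+ 2 <= 0.
Proof.
have [hD hE _ [rD rE] _] := hDE.
move=> lL kl.
have -> : D l x * E l x + k * D l x ^+ 2 = (E l x + k * D l x) * D l x by ring.
have [C C0 hC] := rapid_mul_decay2 x rD rE lL lL.
have [B B0 hB] := rapid_mul_decay2 x rD rD lL lL.
have d y : is_derive y (1 : R) (fun z => (E l z + k * D l z) * D l z)
    (y ^+ 2 * D l y ^+ 2 + (E l y + k * D l y) ^+ 2).
  have d1 := hD l y lL; have d3 := hE l y lL.
  der; have -> : l = - k ^+ 2 by lra.
  by ring.
apply: (@ndecr_decay_le0 _ (fun z => (E l z + k * D l z) * D l z) x (C + `|k| * B)).
  move=> y xy; apply: (global_derivative_ge0_le d) => // z _ _.
  by rewrite -exprMn addr_ge0// sqr_ge0.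
move=> y xy; have := hC y xy; have := hB y xy => h1 h2.
have -> : (E l y + k * D l y) * D l y = D l y * E l y + k * (D l y * D l y) by ring.
rewrite (le_trans (ler_normD _ _))// mulrDl lerD// normrM -mulrA.
by rewrite ler_wpM2l.
Qed.

(** For [l < 0] the product [D E] is nondecreasing in [x], and it is nonpositive by [weber_low]. A
    zero of [D] would make it vanish from there on, and its derivative, a positive definite form in
    [(D, E)], would vanish too. *)
Lemma weber_low_neq0 (l x : R) : l < L -> l < 0 -> D l x != 0.
Proof.
have [hD hE _ [rD rE] h0] := hDE.
move=> lL l0; apply/eqP => Dx.
have d y : is_derive y (1 : R) (fun z => D l z * E l z)
    (E l y ^+ 2 + (y ^+ 2 - l) * D l y ^+ 2).
  have d1 := hD l y lL; have d3 := hE l y lL.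
  by der; ring.
have nn y : 0 <= E l y ^+ 2 + (y ^+ 2 - l) * D l y ^+ 2.
  apply: addr_ge0; first exact: sqr_ge0.
  by apply: mulr_ge0 (sqr_ge0 _); have := sqr_ge0 y; lra.
have z0 y : x <= y -> D l y * E l y = 0.
  move=> xy; apply/eqP; rewrite eq_le; apply/andP; split; last first.
    by have := global_derivative_ge0_le d (fun z _ _ => nn z) xy; rewrite Dx mul0r.
  have := @weber_low l (Num.sqrt (- l)) y lL.
  rewrite sqr_sqrtr; last by lra.
  have := mulr_ge0 (sqrtr_ge0 (- l)) (sqr_ge0 (D l y)).
  by move=> h1 /(_ erefl); lra.
have x1 : x < x + 1 by lra.
have cD : {within `[x, x + 1], continuous (fun z => D l z * E l z)}.
  by apply: continuous_within => y; exact: is_derive_continuous (d y).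
have [c] := MVT x1 (fun y _ => d y) cD.
rewrite !z0; [|lra|lra]; rewrite subrr => _ e.
have e' : E l c ^+ 2 + (c ^+ 2 - l) * D l c ^+ 2 = 0 by lra.
have h1 : 0 <= (c ^+ 2 - l) * D l c ^+ 2.
  by apply: mulr_ge0 (sqr_ge0 _); have := sqr_ge0 c; lra.
have h2 : 0 < c ^+ 2 - l by have := sqr_ge0 c; lra.
have h3 : (c ^+ 2 - l) * D l c ^+ 2 = 0 by have := sqr_ge0 (E l c); lra.
have h4 : E l c ^+ 2 = 0 by lra.
apply: (h0 l c lL); split; apply/eqP; last by rewrite -sqrf_eq0 h4.
by move/eqP: h3; rewrite mulf_eq0 gt_eqF//= sqrf_eq0.
Qed.

(** Without such a zero the ratio of the two boundary functions would increase strictly on [[a, b]],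
    yet it is 0 at both ends. At the ends the two functions cannot vanish together, as [D] would
    vanish with them. *)
Lemma boundary_zero_between (g g' a b x : R) : g < g' -> a < b -> b < L ->
  E a x - g' * D a x = 0 -> E b x - g' * D b x = 0 ->
  exists2 l, a < l < b & E l x - g * D l x = 0.
Proof.
move=> gg' ab bL ea eb; apply: contrapT => h.
have ne l : l < L -> E l x - g' * D l x = 0 -> E l x - g * D l x != 0.
  move=> lL e; have := weber_at_zero lL e; apply: contraNneq => e2.
  have : (g' - g) * D l x = 0 by lra.
  by move/eqP; rewrite mulf_eq0 subr_eq0 gt_eqF.
have : (E a x - g' * D a x) / (E a x - g * D a x) <
       (E b x - g' * D b x) / (E b x - g * D b x).
  apply: boundary_ratio_increasing => // l.
  rewrite le_eqVlt => /predU1P[<- _|al]; first by apply: ne => //; lra.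
  rewrite le_eqVlt => /predU1P[->|lb]; first exact: ne.
  by apply/eqP => e; apply: h; exists l; rewrite ?al.
by rewrite ea eb !mul0r ltxx.
Qed.

(** Interlacing with the left end sent far down: at a very negative parameter both boundary
    functions have the sign opposite to [D], so their ratio is positive and cannot increase to its
    value 0 at [b]. *)
Lemma boundary_zero_below (g g' b x : R) : g < g' -> b < L ->
  E b x - g' * D b x = 0 -> exists2 l, l < b & E l x - g * D l x = 0.
Proof.
move=> gg' bL eb; apply: contrapT => h.
have neb : E b x - g * D b x != 0.
  have := weber_at_zero bL eb; apply: contraNneq => e2.
  have : (g' - g) * D b x = 0 by lra.
  by move/eqP; rewrite mulf_eq0 subr_eq0 gt_eqF.
(* Exceeding [|g|] and [|g'|] lets [weber_low] fix both signs at [a]; exceeding 1 and [|b|] gives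
   [a < b]. *)
pose k := `|g| + `|g'| + `|b| + 1; pose a := - k ^+ 2.
have g0 := normr_ge0 g; have g'0 := normr_ge0 g'; have b0 := normr_ge0 b.
have k1 : 1 <= k by rewrite /k; lra.
have kk : k <= k ^+ 2 by rewrite expr2 ler_peMr//; lra.
have ab : a < b by have := ler_norm (- b); rewrite normrN /a /k in kk *; lra.
have aL : a < L by lra.
have a0 : a < 0 by rewrite /a; lra.
have D0 := weber_low_neq0 x aL a0.
have low : D a x * E a x + k * D a x ^+ 2 <= 0.
  by apply: weber_low => //; rewrite /a opprK.
have D2 : 0 < D a x ^+ 2 by rewrite exprn_even_gt0.
have neg c : `|c| < k -> (E a x - c * D a x) * D a x < 0.
  rewrite ltr_norml => /andP[c1 _].
  have : 0 < (k + c) * D a x ^+ 2 by rewrite mulr_gt0//; lra.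
  by rewrite expr2 in low *; lra.
have n1 := neg g ltac:(rewrite /k; lra).
have n2 := neg g' ltac:(rewrite /k; lra).
have : (E a x - g' * D a x) / (E a x - g * D a x) <
       (E b x - g' * D b x) / (E b x - g * D b x).
  apply: boundary_ratio_increasing => // l _.
  rewrite le_eqVlt => /predU1P[->//|lb].
  by apply/eqP => e; apply: h; exists l.
rewrite eb mul0r; apply/negP; rewrite -leNgt.
have -> : (E a x - g' * D a x) / (E a x - g * D a x) =
    ((E a x - g' * D a x) * D a x) / ((E a x - g * D a x) * D a x).
  by rewrite -mulf_div divff// mulr1.
by rewrite ltW// nmulr_rgt0 ?invr_lt0.
Qed.

(** The normalized boundary function is negative just below [l] and positive just above, which is
    stable under a small move of [x]. If it is also positive at [l] itself for the moved point, the
    sign change has slipped strictly below [l]. *)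
Lemma boundary_zero_persists (l x g e : R) : l < L -> E l x - g * D l x = 0 ->
  0 < e -> exists2 d, 0 < d & forall y, `|y - x| < d ->
    (exists2 k, l - e < k < l + e & E k y - g * D k y = 0) /\
    (0 < D l x * (E l y - g * D l y) ->
     exists2 k, l - e < k < l & E k y - g * D k y = 0).
Proof.
have [hD hE hc _ _] := hDE.
move=> lL e0 epos; have [d d0 hd] := weber_sign_near lL e0.
pose r := Num.min e d / 2.
have me : Num.min e d <= e by rewrite ge_min lexx.
have md : Num.min e d <= d by rewrite ge_min lexx orbT.
have m0 : 0 < Num.min e d by rewrite lt_min epos.
have r0 : 0 < r by rewrite /r; lra.
have re : r < e by rewrite /r; lra.
have rd : r < d by rewrite /r; lra.
have [pL pS] : l + r < L /\ 0 < D l x * (E (l + r) x - g * D (l + r) x).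
  have e1 : l + r - l = r by ring.
  have := hd (l + r); rewrite e1 gtr0_norm// => /(_ rd)[? hs]; split => //.
  have : l + r != l by rewrite gt_eqF//; lra.
  by move=> /hs; rewrite pmulr_rgt0.
have [mL mS] : l - r < L /\ D l x * (E (l - r) x - g * D (l - r) x) < 0.
  have e1 : l - r - l = - r by ring.
  have := hd (l - r); rewrite e1 normrN gtr0_norm// => /(_ rd)[? hs]; split => //.
  have : l - r != l by rewrite lt_eqF//; lra.
  by move=> /hs; rewrite nmulr_rgt0//; lra.
have cx k : k < L -> {for x, continuous (fun y => D l x * (E k y - g * D k y))}.
  move=> kL; apply: continuousM; first exact: cst_continuous.
  have [cD cE] := weber_continuous x kL.
  by apply: continuousB => //; apply: continuousM => //; exact: cst_continuous.
(* Separate continuity suffices: the parameters [l + r] and [l - r] are fixed before the point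
   moves, and the intermediate value theorem in [k] is applied at [y] afterwards. *)
have [d1 d10 hd1] := continuous_neq0_sign (cx _ pL) (lt0r_neq0 pS).
have [d2 d20 hd2] := continuous_neq0_sign (cx _ mL) (ltr0_neq0 mS).
exists (Num.min d1 d2); first by rewrite lt_min d10.
move=> y; rewrite lt_min => /andP[/hd1 y1 /hd2 y2].
rewrite pmulr_rgt0// in y1; rewrite nmulr_rgt0// in y2.
have Dn : D l x != 0 by exact: weber_at_zero e0.
have cw a b : b < L ->
    {within `[a, b], continuous (fun k => D l x * (E k y - g * D k y))}.
  move=> bL; apply: continuous_in_subspaceT => k.
  rewrite inE/= in_itv/= => /andP[_ kb].
  have kL : k < L by lra.
  have cc : {for k, continuous (fun _ : R => D l x)} by exact: cst_continuous.
  exact: (continuousM cc (@boundary_continuous k y g kL)).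
have zero k : D l x * (E k y - g * D k y) = 0 -> E k y - g * D k y = 0.
  by move/eqP; rewrite mulf_eq0 (negbTE Dn)/= => /eqP.
split.
  have lr : l - r < l + r by lra.
  have [|c /andP[c1 c2] /zero c0] := IVT_sign lr (cw (l - r) _ pL).
    by rewrite nmulr_rlt0.
  by exists c => //; lra.
move=> pos.
have lr : l - r < l by lra.
have [|c /andP[c1 c2] /zero c0] := IVT_sign lr (cw (l - r) _ lL).
  by rewrite nmulr_rlt0.
by exists c => //; lra.
Qed.

(** At the zero, the normalized boundary function has [x]-derivative [D^2 (x^2 - l - g^2)]. It is
    therefore positive at points arbitrarily close to [x], as the second half of
    [boundary_zero_persists] demands. *)
Lemma boundary_crosses (l x g d : R) : l < L -> E l x - g * D l x = 0 ->
  x ^+ 2 - l - g ^+ 2 != 0 -> 0 < d ->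
  exists2 y, `|y - x| < d & 0 < D l x * (E l y - g * D l y).
Proof.
have [hD hE _ _ _] := hDE.
move=> lL e0 ne d0; have Dn := weber_at_zero lL e0.
have dd y : is_derive y (1 : R) (fun z => D l x * (E l z - g * D l z))
    (D l x * ((y ^+ 2 - l) * D l y - g * E l y)).
  have d1 := hD l y lL; have d3 := hE l y lL.
  by der; ring.
apply: (derivative_neq0_gt0 d0 (fun y => @ex_derive _ _ _ _ _ _ _ (dd y)) (dd x)).
  have -> : E l x = g * D l x by lra.
  have -> : D l x * ((x ^+ 2 - l) * D l x - g * (g * D l x)) =
    D l x ^+ 2 * (x ^+ 2 - l - g ^+ 2) by ring.
  by rewrite mulf_neq0// sqrf_eq0.
by rewrite e0 mulr0.
Qed.

End spectral_function.

(** * Solutions on the half-line *)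

Lemma L2_Rplus_integrable (R : realType) (u : R -> R) : L2_Rplus u ->
  (@lebesgue_measure R).-integrable `[0, +oo[ (EFin \o (fun t => u t ^+ 2)).
Proof.
move=> /Lfun2_integrable_sqr iu.
have : (@lebesgue_measure R).-integrable `[0, +oo[
    (EFin \o (fun t => (u \_ (@Rplus R)) t ^+ 2)).
  by apply: integrableS iu.
by apply: eq_integrable => // t tR /=; rewrite patchE tR.
Qed.

Lemma integrable_L2_Rplus (R : realType) (u : R -> R) :
  measurable_fun (@Rplus R) u ->
  (@lebesgue_measure R).-integrable `[0, +oo[ (EFin \o (fun t => u t ^+ 2)) ->
  L2_Rplus u.
Proof.
move=> mu iu; rewrite /L2_Rplus inE; apply/andP; split.
  by rewrite inE/=; apply/(measurable_restrictT _ _).1 => //; exact: measurable_itv.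
rewrite inE/= /finite_norm unlock; apply: poweR_lty.
rewrite (_ : (\int[_]_x _)%E =
  (\int[@lebesgue_measure R]_(x in `[0%R, +oo[) (u x ^+ 2)%:E)%E).
  exact: integrable_lty.
rewrite [RHS]integral_mkcond; apply: eq_integral => t _ /=.
rewrite !patchE; case: ifPn => _ /=; last by rewrite normr0 powR0.
by rewrite powR_mulrn// -normrX ger0_norm ?sqr_ge0.
Qed.

Lemma primitive_within (R : realType) (f f' : R -> R) (T : R) : 0 <= T ->
  primitive_Rplus f f' -> {within `[0, T], continuous f}.
Proof.
move=> T0 hf; have [iT _] := hf T T0.
have h := parameterized_integral_continuous T0 iT.
have c0 : {within `[0, T], continuous (fun _ : R => f 0)}.
  by apply: continuous_within => t; exact: cst_continuous.
have := within_continuous_add c0 h; apply: subspace_eq_continuous => t.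
rewrite inE/= in_itv/= => /andP[t0 _]; exact/esym/(hf t t0).2.
Qed.

Lemma halfline_continuous_at (R : realType) (f : R -> R) :
  (forall T, 0 <= T -> {within `[0, T], continuous f}) ->
  forall t, 0 < t -> {for t, continuous f}.
Proof.
move=> cf t t0; have t1 : 0 < t + 1 by lra.
have /(continuous_within_itvP _ t1)[h _ _] := cf (t + 1) (ltW t1).
by apply: h; rewrite in_itv/=; lra.
Qed.

Lemma primitive_is_derive (R : realType) (f f' : R -> R) (t : R) : 0 < t ->
  primitive_Rplus f f' -> {for t, continuous f'} -> is_derive t (1 : R) f (f' t).
Proof.
move=> t0 hf cf'; have t1 : t < t + 1 by lra.
have [iT _] := hf (t + 1) ltac:(lra).
have [d1 d2] := continuous_FTC1_closed t1 iT t0 cf'.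
set F := (fun x => _) in d1 d2.
have dF : is_derive t (1 : R) (fun x => f 0 + F x) (f' t).
  have dI : is_derive t (1 : R) F (f' t) by apply: DeriveDef d1 _; rewrite -derive1E.
  exact: (is_derive_conv (is_derive_add (is_derive_const (f 0) t) dI) (add0r _)).
have e : \near t, (fun x => f 0 + F x) t = f t.
  near=> x; rewrite -(hf x _).2//; apply: ltW; near: x; exact: lt_nbhsr.
split.
  apply: near_eq_derivable e _ => //; exact: @ex_derive.
by rewrite -(near_eq_derive _ e)//; exact: derive_val.
Unshelve. all: end_near. Qed.

(** Regularity step: the a.e. derivative of [u'] is replaced by the continuous expression given by
    the equation, after which [u] is a classical solution. *)
Lemma primitive_ae (R : realType) (f f' h : R -> R) :
  primitive_Rplus f f' ->
  (forall T, 0 <= T -> {within `[0, T], continuous h}) ->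
  {ae @lebesgue_measure R, forall t : R, Rplus t -> f' t = h t} ->
  primitive_Rplus f h.
Proof.
move=> hf ch ae t t0; have [it ->] := hf t t0.
have ih : (@lebesgue_measure R).-integrable `[0, t] (EFin \o h).
  by apply: continuous_compact_integrable; [exact: segment_compact|exact: ch].
split => //; congr (_ + _); rewrite /Rintegral; congr fine.
apply: ae_eq_integral => //.
- exact: measurable_int it.
- exact: measurable_int ih.
apply: (@filterS _ _ (ae_filter_ringOfSetsType _)) ae => s hs.
rewrite /= in_itv/= => /andP[s0 _].
by rewrite /= hs// /Rplus/= in_itv/= s0.
Qed.

Lemma smooth_primitive (R : realType) (f f' : R -> R) :
  (forall t, is_derive t (1 : R) f (f' t)) -> (forall t, {for t, continuous f'}) ->
  primitive_Rplus f f'.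
Proof.
move=> df cf t t0; split.
  apply: continuous_compact_integrable; first exact: segment_compact.
  exact: continuous_within.
move: t0; rewrite le_eqVlt => /predU1P[<-|t0].
  by rewrite set_itv1 Rintegral_set1 addr0.
rewrite /Rintegral (@continuous_FTC2 _ _ f) //.
- by rewrite -EFinB /= addrC subrK.
- exact: continuous_within.
- have cf0 x : {for x, continuous f} by exact: is_derive_continuous (df x).
  split.
  - by move=> x _; have h := df x; apply: ex_derive.
  - by apply: cvg_at_right_filter; exact: cf0.
  - by apply: cvg_at_left_filter; exact: cf0.
- by move=> x _; have h := df x; rewrite derive1E; exact: derive_val.
Qed.

(** Derivatives are two-sided, hence asked for only at [t > 0]: [u] is arbitrary on the negative
    half-line. The initial data at 0 are reached through continuity on [[0, T]]. *)
Definition halfline_solution (R : realType) (s l : R) (u u1 : R -> R) : Prop :=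
  [/\ forall T : R, 0 <= T -> {within `[0, T], continuous u},
      forall T : R, 0 <= T -> {within `[0, T], continuous u1},
      forall t : R, 0 < t -> is_derive t (1 : R) u (u1 t) &
      forall t : R, 0 < t -> is_derive t (1 : R) u1 (((t - s) ^+ 2 - l) * u t)].

Lemma robin_graph_solution (R : realType) (g s l : R) (u : R -> R) :
  robin_graph g s u (fun t => l * u t) ->
  exists2 u1, halfline_solution s l u u1 & u1 0 = g * u 0.
Proof.
move=> [_ _ [u1 [u2 [hu hu1 bc ae]]]]; exists u1 => //.
have cu T : 0 <= T -> {within `[0, T], continuous u}.
  by move=> T0; exact: primitive_within hu.
have cu1 T : 0 <= T -> {within `[0, T], continuous u1}.
  by move=> T0; exact: primitive_within hu1.
have ch T : 0 <= T -> {within `[0, T], continuous (fun t => ((t - s) ^+ 2 - l) * u t)}.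
  move=> T0; apply: within_continuous_mul; last exact: cu.
  apply: continuous_within => t.
  by apply: (@is_derive_continuous _ _ _ (2 * (t - s))); der; ring.
have hu1' : primitive_Rplus u1 (fun t => ((t - s) ^+ 2 - l) * u t).
  apply: primitive_ae hu1 ch _.
  by apply: (@filterS _ _ (ae_filter_ringOfSetsType _)) ae => t ht /ht; lra.
split; [exact: cu|exact: cu1|move=> t t0|move=> t t0].
  exact: (primitive_is_derive t0 hu (halfline_continuous_at cu1 t0)).
exact: (primitive_is_derive t0 hu1' (halfline_continuous_at ch t0)).
Qed.

(* Gronwall, with weight exp (- M t). *)
Lemma halfline_solution_unique (R : realType) (s l : R) (u u1 : R -> R) :
  halfline_solution s l u u1 -> u 0 = 0 -> u1 0 = 0 ->
  forall t : R, 0 <= t -> u t = 0 /\ u1 t = 0.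
Proof.
move=> [cu cu1 du du1] u0 u10 t t0.
(* Bounds [|1 + ((x - s) ^+ 2 - l)|] on [[0, t]], the coefficient of [2 u u1] in the derivative of
   [u^2 + u1^2]. *)
pose M := 1 + (t + `|s|) ^+ 2 + `|l|.
pose h x := (u x ^+ 2 + u1 x ^+ 2) * expR (- (M * x)).
have M0 : 0 <= M by rewrite /M addr_ge0// addr_ge0// sqr_ge0.
have dh (x : R) : 0 < x -> is_derive x (1 : R) (fun x => - h x)
    ((M * (u x ^+ 2 + u1 x ^+ 2) - 2 * (1 + ((x - s) ^+ 2 - l)) * (u x * u1 x)) *
      expR (- (M * x))).
  move=> x0; have d1 := du x x0; have d2 := du1 x x0.
  by rewrite /h; der; ring.
have ch : {within `[0, t], continuous (fun x : R => - h x)}.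
  apply: within_continuous_opp; apply: within_continuous_mul.
    by apply: within_continuous_add; apply: within_continuous_mul; (apply: cu || apply: cu1).
  apply: continuous_within => x.
  by apply: (@is_derive_continuous _ _ _ (- M * expR (- (M * x)))); der; ring.
have : - h 0 <= - h t.
  apply: (derivative_ge0_le t0 ch (fun x x0 _ => dh x x0)) => x x0 xt.
  rewrite mulr_ge0 ?expR_ge0//.
  have hq : `|1 + ((x - s) ^+ 2 - l)| <= M.
    have hs : (x - s) ^+ 2 <= (t + `|s|) ^+ 2.
      have := ler_norm s; have := ler_norm (- s); rewrite normrN => s1 s2.
      have p1 : 0 <= t + `|s| - (x - s) by lra.
      have p2 : 0 <= t + `|s| + (x - s) by lra.
      by have := mulr_ge0 p1 p2; rewrite !expr2; lra.
    have := ler_norm l; have := ler_norm (- l); rewrite normrN => l1 l2.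
    by rewrite ler_norml /M; have := sqr_ge0 (x - s); lra.
  move: hq; rewrite ler_norml => /andP[q1 q2].
  have p1 := mulr_ge0 (ltac:(lra) : 0 <= M - (1 + ((x - s) ^+ 2 - l))) (sqr_ge0 (u x + u1 x)).
  have p2 := mulr_ge0 (ltac:(lra) : 0 <= M + (1 + ((x - s) ^+ 2 - l))) (sqr_ge0 (u x - u1 x)).
  by rewrite !expr2 in p1 p2 *; lra.
rewrite /h u0 u10 expr0n/= addr0 mul0r oppr0 lerNr oppr0 pmulr_lle0 ?expR_gt0// => e.
have := sqr_ge0 (u t); have := sqr_ge0 (u1 t) => e1 e2.
by split; apply/eqP; rewrite -sqrf_eq0; apply/eqP; lra.
Qed.

Lemma integrable_not_above (R : realType) (f : R -> R) (a c : R) :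
  (@lebesgue_measure R).-integrable `[0, +oo[ (EFin \o f) ->
  (forall t : R, 0 <= t -> 0 <= f t) -> 0 <= a -> 0 < c ->
  ~ (forall t : R, a <= t -> c <= f t).
Proof.
move=> fi f0 a0 c0 h.
pose I := \int[@lebesgue_measure R]_(t in `[0, +oo[) f t.
have I0 : 0 <= I.
  by apply: Rintegral_ge0 => t; rewrite /= in_itv/= andbT; exact: f0.
have ab : a < a + (I + 1) / c by rewrite ltrDl divr_gt0//; lra.
have : c * (a + (I + 1) / c - a) <= I.
  apply: Rintegral_ge_segment => //.
  - by move=> t; rewrite /= in_itv/= andbT; exact: f0.
  - by move=> t; rewrite /= !in_itv/= andbT; lra.
  - exact: ltW.
  - by move=> t at_ _; exact: h.
have -> : c * (a + (I + 1) / c - a) = I + 1 by field; exact: lt0r_neq0.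
by lra.
Qed.

Lemma halfline_within (R : realType) (f : R -> R) (a b : R) : 0 <= a -> a <= b ->
  (forall T : R, 0 <= T -> {within `[0, T], continuous f}) ->
  {within `[a, b], continuous f}.
Proof.
move=> a0 ab cf; apply: continuous_subspaceW (cf b (le_trans a0 ab)).
by move=> t; rewrite /= !in_itv/= => /andP[at_ ->]; rewrite (le_trans a0 at_).
Qed.

(** Beyond [T] the coefficient [(t - s)^2 - l] is nonnegative, so [u u1] is nondecreasing. Were it
    positive somewhere, [u^2] would increase from there and not be integrable. Hence [u u1 <= 0],
    which makes both [u^2] and [u1^2] nonincreasing. *)
Lemma halfline_solution_bounded (R : realType) (s l : R) (u u1 : R -> R) :
  halfline_solution s l u u1 ->
  (@lebesgue_measure R).-integrable `[0, +oo[ (EFin \o (fun t : R => u t ^+ 2)) ->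
  exists2 T, 0 <= T & exists2 B, 0 <= B &
    forall t : R, T <= t -> `|u t| <= B /\ `|u1 t| <= B.
Proof.
move=> [cu cu1 du du1] iu.
pose T : R := `|s| + `|l| + 1.
have s0 := normr_ge0 s; have l0 := normr_ge0 l.
have T0 : 0 < T by rewrite /T; lra.
have q0 (t : R) : T <= t -> 0 <= (t - s) ^+ 2 - l.
  move=> Tt; have := ler_norm s; have := ler_norm l; rewrite /T in Tt => h1 h2.
  have h3 : `|l| + 1 <= t - s by lra.
  have h4 : (`|l| + 1) * 1 <= (t - s) * (t - s) by apply: ler_pM => //; lra.
  by rewrite expr2; lra.
have cuu1 (a b : R) : T <= a -> a <= b ->
    {within `[a, b], continuous (fun t : R => u t * u1 t)}.
  by move=> Ta ab; apply: within_continuous_mul; apply: halfline_within => //; lra.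
have duu1 (t : R) : 0 < t -> is_derive t (1 : R) (fun t : R => u t * u1 t)
    (u1 t ^+ 2 + ((t - s) ^+ 2 - l) * u t ^+ 2).
  by move=> t0; have d1 := du t t0; have d2 := du1 t t0; der; ring.
have cu2 (a b : R) : T <= a -> a <= b ->
    {within `[a, b], continuous (fun t : R => u t ^+ 2)}.
  move=> Ta ab; rewrite (_ : (fun t : R => u t ^+ 2) = fun t : R => u t * u t) //.
  by apply: within_continuous_mul; apply: halfline_within => //; lra.
have du2 (t : R) : 0 < t -> is_derive t (1 : R) (fun t : R => u t ^+ 2) (2 * (u t * u1 t)).
  by move=> t0; have d1 := du t t0; der; ring.
have cu12 (a b : R) : T <= a -> a <= b ->
    {within `[a, b], continuous (fun t : R => - u1 t ^+ 2)}.
  move=> Ta ab; rewrite (_ : (fun t : R => - u1 t ^+ 2) = fun t : R => - (u1 t * u1 t)) //.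
  apply: within_continuous_opp.
  by apply: within_continuous_mul; apply: halfline_within => //; lra.
have du12 (t : R) : 0 < t -> is_derive t (1 : R) (fun t : R => - u1 t ^+ 2)
    (2 * ((t - s) ^+ 2 - l) * - (u t * u1 t)).
  by move=> t0; have d1 := du1 t t0; der; ring.
have mono (a b : R) : T <= a -> a <= b -> u a * u1 a <= u b * u1 b.
  move=> Ta ab.
  apply: (@derivative_ge0_le _ (fun t : R => u t * u1 t) _ _ _ ab (cuu1 a b Ta ab)
    (fun t at_ _ => duu1 t (lt_trans T0 (le_lt_trans Ta at_)))).
  move=> t at_ _; have := q0 t ltac:(lra) => qt.
  by rewrite addr_ge0 ?sqr_ge0// mulr_ge0// sqr_ge0.
have neg (a : R) : T <= a -> u a * u1 a <= 0.
  move=> Ta; rewrite leNgt; apply/negP => pos.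
  have ua : 0 < u a ^+ 2.
    by rewrite exprn_even_gt0//=; apply: contraTneq pos => ->; rewrite mul0r ltxx.
  apply: (@integrable_not_above _ _ a _ iu _ _ ua).
  - by move=> t _; rewrite sqr_ge0.
  - by lra.
  move=> t at_; apply: (@derivative_ge0_le _ (fun t : R => u t ^+ 2) _ _ _ at_
    (cu2 a t Ta at_) (fun x ax _ => du2 x (lt_trans T0 (le_lt_trans Ta ax)))).
  by move=> x ax _; have := mono a x Ta (ltW ax); lra.
exists T; first exact: ltW.
have bnd (x y : R) : x ^+ 2 <= y ^+ 2 -> `|x| <= `|y|.
  by move=> h; rewrite -ler_sqr ?nnegrE// !real_normK// num_real.
exists (`|u T| + `|u1 T|); first by rewrite addr_ge0.
move=> t Tt; split.
  apply: (@le_trans _ _ `|u T|); last by rewrite lerDl.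
  apply: bnd; rewrite -lerN2.
  apply: (@derivative_ge0_le _ (fun t : R => - u t ^+ 2)
    (fun t : R => - (2 * (u t * u1 t))) _ _ Tt).
  - by apply: within_continuous_opp; exact: cu2.
  - by move=> x x0 _; apply: is_derive_opp; apply: du2; lra.
  - by move=> x Tx _; have := neg x (ltW Tx); lra.
apply: (@le_trans _ _ `|u1 T|); last by rewrite lerDr.
apply: bnd; rewrite -lerN2.
apply: (@derivative_ge0_le _ (fun t : R => - u1 t ^+ 2) _ _ _ Tt (cu12 T t (lexx T) Tt)
  (fun x Tx _ => du12 x (lt_trans T0 Tx))).
move=> x Tx _; rewrite mulr_ge0//; first by have := q0 x (ltW Tx); lra.
by rewrite oppr_ge0; apply: neg; exact: ltW.
Qed.

(** * Square-integrable solutions are multiples of the decaying one *)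

Section eigenvalues.
Context (R : realType) (L : R) (D E : R -> R -> R) (hDE : weber_family L D E).

Lemma weber_halfline_solution (s l c : R) : l < L ->
  halfline_solution s l (fun t : R => c * D l (t - s)) (fun t : R => c * E l (t - s)).
Proof.
have [hD hE _ _ _] := hDE; move=> lL.
have d1 y := hD l y lL; have d2 y := hE l y lL.
have dD (t : R) : is_derive t (1 : R) (fun t : R => c * D l (t - s)) (c * E l (t - s)).
  by der; ring.
have dE (t : R) : is_derive t (1 : R) (fun t : R => c * E l (t - s))
    (((t - s) ^+ 2 - l) * (c * D l (t - s))).
  by der; ring.
split.
- by move=> T _; apply: continuous_within => t; exact: is_derive_continuous (dD t).
- by move=> T _; apply: continuous_within => t; exact: is_derive_continuous (dE t).
- by move=> t _.
- by move=> t _.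
Qed.

(* The Wronskian of an [L^2] solution with the decaying solution is constant
   and tends to 0, so the two are proportional. *)
Lemma L2_solution_proportional (s l : R) (u u1 : R -> R) : l < L ->
  halfline_solution s l u u1 ->
  (@lebesgue_measure R).-integrable `[0, +oo[ (EFin \o (fun t : R => u t ^+ 2)) ->
  exists c : R, forall t : R, 0 <= t -> u t = c * D l (t - s) /\ u1 t = c * E l (t - s).
Proof.
move=> lL hu iu.
have [T T0 [B B0 hB]] := halfline_solution_bounded hu iu.
have [hD hE _ [rD rE] h0] := hDE.
have hv := weber_halfline_solution s 1 lL.
have [cu cu1 du du1] := hu; have [cv cv1 dv dv1] := hv.
pose W (t : R) := u t * (1 * E l (t - s)) - u1 t * (1 * D l (t - s)).
have cW (a b : R) : 0 <= a -> a <= b -> {within `[a, b], continuous W}.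
  move=> a0 ab; apply: within_continuous_add; last apply: within_continuous_opp;
  by apply: within_continuous_mul; apply: halfline_within.
have dW (t : R) : 0 < t -> is_derive t (1 : R) W 0.
  move=> t0; have d1 := du t t0; have d2 := du1 t t0.
  have d3 := dv t t0; have d4 := dv1 t t0.
  apply: (@is_derive_conv _ _ _ (u t * (((t - s) ^+ 2 - l) * (1 * D l (t - s))) +
     1 * E l (t - s) * u1 t + - (u1 t * (1 * E l (t - s)) +
     1 * D l (t - s) * (((t - s) ^+ 2 - l) * u t)))); last by ring.
  apply: is_derive_add; first exact: is_derive_mul.
  by apply: is_derive_opp; exact: is_derive_mul.
have Wc (a b : R) : 0 <= a -> a <= b -> W a = W b.
  move=> a0 ab; apply: (derivative0_eq ab (cW a b a0 ab)) => t at_ _.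
  by apply: dW; lra.
have [C1 C10 hC1] := rD l l (T - s) 1 lL.
have [C2 C20 hC2] := rE l l (T - s) 1 lL.
have WT : W T = 0.
  apply: (@cst_decay_eq0 _ W T (B * (C1 + C2) * expR s)).
    by move=> t Tt; exact: Wc.
  move=> t Tt; have [b1 b2] := hB t Tt.
  have ts : T - s <= t - s by lra.
  have := hC1 l _ (lexx l) (lexx l) ts; have := hC2 l _ (lexx l) (lexx l) ts.
  have -> : - (1 * (t - s)) = s + - t by ring.
  rewrite expRD => e2 e1; rewrite /W !mul1r (le_trans (ler_normB _ _))//.
  have -> : B * (C1 + C2) * expR s * expR (- t) =
    B * (C2 * (expR s * expR (- t))) + B * (C1 * (expR s * expR (- t))) by ring.
  by rewrite !normrM; apply: lerD; apply: ler_pM.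
have W0 : u 0 * E l (0 - s) = u1 0 * D l (0 - s).
  by have := Wc 0 T (lexx 0) T0; rewrite WT /W !mul1r; lra.
(* A zero Wronskian at 0 makes the initial data proportional; uniqueness for [u - c D] then
   propagates this. *)
have [c [c1 c2]] : exists c : R, u 0 = c * D l (0 - s) /\ u1 0 = c * E l (0 - s).
  have [Dz|Dn] := eqVneq (D l (0 - s)) 0.
    have En : E l (0 - s) != 0.
      by apply/eqP => Ez; apply: (h0 l (0 - s) lL).
    exists (u1 0 / E l (0 - s)); rewrite Dz mulr0 divfK//; split => //.
    move: W0; rewrite Dz mulr0 => /eqP; rewrite mulf_eq0 (negbTE En) orbF.
    by move=> /eqP.
  exists (u 0 / D l (0 - s)); rewrite divfK//; split => //.
  by rewrite mulrAC W0 mulfK.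
exists c; have [cw cw1 dw dw1] := weber_halfline_solution s (- c) lL.
have hd : halfline_solution s l (fun t : R => u t + - c * D l (t - s))
    (fun t : R => u1 t + - c * E l (t - s)).
  split.
  - by move=> A A0; apply: within_continuous_add; [exact: cu|exact: cw].
  - by move=> A A0; apply: within_continuous_add; [exact: cu1|exact: cw1].
  - by move=> t t0; apply: is_derive_add; [exact: du|exact: dw].
  - move=> t t0; rewrite mulrDr; apply: is_derive_add; [exact: du1|exact: dw1].
move=> t t0; have [] := halfline_solution_unique hd _ _ t0.
- by rewrite c1; ring.
- by rewrite c2; ring.
- by move=> h1 h2; split; lra.
Qed.

End eigenvalues.

(** * Eigenvalues of the Robin operator *)

Section robin_eigenvalues.
Context (R : realType) (L : R) (D E : R -> R -> R) (hDE : weber_family L D E).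

Lemma weber_sqr_integrable (s l c : R) : l < L ->
  (@lebesgue_measure R).-integrable `[0, +oo[
    (EFin \o (fun t => (c * D l (t - s)) ^+ 2)).
Proof.
have [hD _ _ [rD _] _] := hDE; move=> lL.
have d1 y := hD l y lL.
have [C C0 hC] := rapid_mul_decay2 (- s) rD rD lL lL.
apply: (@integrable_decay _ _ _ (c ^+ 2 * (C * expR s))).
  apply: continuous_measurable_on => // t.
  apply: (@is_derive_continuous _ _ _
    (2 * (c * D l (t - s)) * (c * E l (t - s)))).
  by der; ring.
move=> t t0; have := hC (t - s) ltac:(lra).
have -> : - (t - s) = s + - t by ring.
rewrite expRD => h.
have -> : (c * D l (t - s)) ^+ 2 = c ^+ 2 * (D l (t - s) * D l (t - s)) by ring.
have -> : c ^+ 2 * (C * expR s) * expR (- t) =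
  c ^+ 2 * (C * (expR s * expR (- t))) by ring.
by rewrite normrM (ger0_norm (sqr_ge0 c)); exact: ler_wpM2l (sqr_ge0 c) _ _ h.
Qed.

Lemma weber_L2_Rplus (s l c : R) : l < L -> L2_Rplus (fun t => c * D l (t - s)).
Proof.
have [hD _ _ _ _] := hDE; move=> lL; have d1 y := hD l y lL.
apply: integrable_L2_Rplus (weber_sqr_integrable s c lL).
apply: continuous_measurable_on => [t|]; last exact: measurable_itv.
by apply: (@is_derive_continuous _ _ _ (c * E l (t - s))); der; ring.
Qed.

Lemma weber_robin_graph (g s l : R) : l < L -> E l (- s) - g * D l (- s) = 0 ->
  robin_graph g s (fun t => D l (t - s)) (fun t => l * D l (t - s)).
Proof.
have [hD hE _ _ _] := hDE; move=> lL bc.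
have d1 y := hD l y lL; have d2 y := hE l y lL.
split; last 1 first.
- exists (fun t => E l (t - s)), (fun t => ((t - s) ^+ 2 - l) * D l (t - s)).
  split.
  + apply: smooth_primitive => t; first by der.
    by apply: (@is_derive_continuous _ _ _ (((t - s) ^+ 2 - l) * D l (t - s))); der.
  + apply: smooth_primitive => t; first by der.
    apply: (@is_derive_continuous _ _ _
      (((t - s) ^+ 2 - l) * E l (t - s) + 2 * (t - s) * D l (t - s))).
    by der; ring.
  + by rewrite sub0r; lra.
  + by apply/aeW => t _; ring.
- have := weber_L2_Rplus s 1 lL; congr L2_Rplus.
  by apply/funext => t; rewrite mul1r.
- exact: weber_L2_Rplus.
Qed.

(** Here [c] may be 0, so the boundary condition is only obtained multiplied by [c]. *)
Lemma robin_graph_weber (g s l : R) (u : R -> R) : l < L ->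
  robin_graph g s u (fun t => l * u t) ->
  exists c, [/\ forall t : R, 0 <= t -> u t = c * D l (t - s),
    forall t : R, 0 < t -> is_derive t 1 u (c * E l (t - s)) &
    c * (E l (- s) - g * D l (- s)) = 0].
Proof.
move=> lL hu; have [l2u _ _] := hu.
have [u1 su bc] := robin_graph_solution hu.
have [c hc] := L2_solution_proportional hDE lL su (L2_Rplus_integrable l2u).
exists c; split; first by move=> t t0; exact: (hc t t0).1.
  by move=> t t0; rewrite -(hc t (ltW t0)).2; have [_ _ du _] := su; exact: du.
have [e1 e2] := hc 0 (lexx 0).
by move: bc; rewrite e1 e2 sub0r => bc; rewrite mulrBr bc; ring.
Qed.

Lemma robin_eigenvalue_boundary (g s l : R) : l < L ->
  robin_eigenvalue g s l <-> E l (- s) - g * D l (- s) = 0.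
Proof.
move=> lL; split.
  move=> [u [hu nz]]; have [c [uc _ /eqP]] := robin_graph_weber lL hu.
  rewrite mulf_eq0 => /orP[/eqP c0|/eqP//].
  exfalso; apply: nz; apply/aeW => t; rewrite /Rplus /= in_itv/= andbT => t0.
  by rewrite uc// c0 mul0r.
move=> bc; exists (fun t => D l (t - s)); split; first exact: weber_robin_graph.
move=> ae.
have [y sy Dy] := weber_neq0_right hDE (- s) lL.
have [hD _ _ _ _] := hDE; have d1 z := hD l z lL.
pose f t := D l (t - s) ^+ 2.
have fi : (@lebesgue_measure R).-integrable `[0, +oo[ (EFin \o f).
  have := weber_sqr_integrable s 1 lL; congr (integrable _ _ (_ \o _)).
  by apply/funext => t; rewrite mul1r.
have : 0 < \int[@lebesgue_measure R]_(t in `[0, +oo[) f t.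
  apply: (@Rintegral_gt0 _ _ _ (y + s)) => //.
  - move=> t; apply: (@is_derive_continuous _ _ _ (2 * D l (t - s) * E l (t - s))).
    by rewrite /f; der; ring.
  - by move=> t; exact: sqr_ge0.
  - by lra.
  - by rewrite /f addrK exprn_even_gt0.
suff -> : \int[@lebesgue_measure R]_(t in `[0, +oo[) f t = 0 by rewrite ltxx.
rewrite /Rintegral (_ : (\int[_]_(t in _) _)%E =
    (\int[@lebesgue_measure R]_(t in `[0%R, +oo[) 0)%E).
  by rewrite integral0.
apply: ae_eq_integral => //.
  exact: measurable_int fi.
apply: (@filterS _ _ (ae_filter_ringOfSetsType _)) ae => t ht t0.
by rewrite /= /f ht// expr0n.
Qed.

Lemma normalized_eigenfunction_weber (g s l : R) (u : R -> R) : l < L ->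
  normalized_eigenfunction g s l u ->
  E l (- s) - g * D l (- s) = 0 /\
  exists c, [/\ c != 0, forall t : R, 0 <= t -> u t = c * D l (t - s) &
    forall t : R, 0 < t -> is_derive t 1 u (c * E l (t - s))].
Proof.
move=> lL [hu n1]; have [c [uc du e]] := robin_graph_weber lL hu.
have c0 : c != 0.
  apply/eqP => c0; have := n1; suff -> : dot_Rplus u u = 0.
    by move/eqP; rewrite eq_sym oner_eq0.
  rewrite /dot_Rplus /Rintegral (_ : (\int[_]_(t in _) _)%E =
      (\int[@lebesgue_measure R]_(t in @Rplus R) 0)%E); first by rewrite integral0.
  apply: eq_integral => t; rewrite inE /Rplus /= in_itv/= andbT => t0.
  by rewrite uc// c0 !mul0r.
split; last by exists c.
by move/eqP: e; rewrite mulf_eq0 (negbTE c0) => /eqP.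
Qed.

End robin_eigenvalues.

(** * Dependence of the eigenvalues on gamma and sigma *)

Section eigenvalue_curves.
Context (R : realType) (mu : nat -> R -> R -> R)
  (hmu : forall gamma sigma : R,
     robin_spectrum gamma sigma (fun j => mu j gamma sigma)).

(** How a zero found by analysis is located in the spectrum: an eigenvalue beyond [mu i.-1] has
    index at least [i]. The guard [1 < i] keeps the meaningless index 0 out. *)
Lemma eigenvalue_rank (g s l : R) (i : nat) : robin_eigenvalue g s l ->
  (0 < i)%N -> ((1 < i)%N -> mu i.-1 g s < l) -> mu i g s <= l.
Proof.
have [inc spec] := hmu g s.
move=> /spec[k k1 ->] i0 h; have ik : (i <= k)%N.
  have [i1|] := ltnP 1 i; last by move=> i1; exact: leq_trans k1.
  have {}h := h i1; rewrite leqNgt; apply/negP => ki.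
  have : (k <= i.-1)%N by case: i i0 i1 h ki.
  rewrite leq_eqVlt => /predU1P[e|ki1]; first by rewrite e ltxx in h.
  by have := lt_trans h (inc _ _ k1 ki1); rewrite ltxx.
by move: ik; rewrite leq_eqVlt => /predU1P[->//|/(inc _ _ i0)/ltW].
Qed.

(** By interlacing, an eigenvalue for [g] lies strictly between [mu i g' s] and [mu i.+1 g' s]. By
    induction it exceeds [mu i g s], so its index is at least [i.+1]. The first eigenvalue uses
    [boundary_zero_below]. *)
Lemma eigenvalue_lt_gamma (i : nat) (g g' s : R) : g < g' -> (0 < i)%N ->
  mu i g s < mu i g' s.
Proof.
move=> gg'; elim: i => // i IH _.
have [inc spec] := hmu g' s.
pose b := mu i.+1 g' s.
have [D [E hDE]] := exists_weber_family (b + 1).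
have bL : b < b + 1 by lra.
have ev k : (0 < k)%N -> mu k g' s < b + 1 ->
    E (mu k g' s) (- s) - g' * D (mu k g' s) (- s) = 0.
  by move=> k0 kL; apply/(robin_eigenvalue_boundary hDE); last (apply/spec; exists k).
have eb := ev i.+1 isT bL.
have [i0|i0] := posnP i.
  have [l lb el] := boundary_zero_below hDE gg' bL eb.
  apply: (le_lt_trans _ lb); apply: eigenvalue_rank => //; last by rewrite i0.
  by apply/(robin_eigenvalue_boundary hDE) => //; lra.
have ab : mu i g' s < b by apply: inc.
have ea := ev i i0 (lt_trans ab bL).
have [l /andP[al lb] el] := boundary_zero_between hDE gg' ab bL ea eb.
apply: (le_lt_trans _ lb); apply: eigenvalue_rank => //.
  by apply/(robin_eigenvalue_boundary hDE) => //; lra.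
by move=> _; apply: (lt_trans _ al); exact: IH.
Qed.

(** The zero at [mu i.+1] persists nearby, and it keeps an index of at least [i.+1] as long as
    [mu i] does not climb past it. This is an upper bound on [mu i], so the induction closes with
    upper semicontinuity alone. *)
Lemma eigenvalue_usc (i : nat) (g s e : R) : (0 < i)%N -> 0 < e ->
  exists2 d, 0 < d & forall s' : R, `|s' - s| < d -> mu i g s' < mu i g s + e.
Proof.
elim: i e => // i IH e _ e0.
have [inc spec] := hmu g s.
pose b := mu i.+1 g s.
have [D [E hDE]] := exists_weber_family (b + 2).
have bL : b < b + 2 by lra.
have eb : E b (- s) - g * D b (- s) = 0.
  by apply/(robin_eigenvalue_boundary hDE) => //; apply/spec; exists i.+1.
(* Half the gap to the previous eigenvalue, which then stays below the midpoint while the persisting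
   zero stays above it. For the first eigenvalue any positive value would do. *)
pose r : R := if (i == 0)%N then 1 else (b - mu i g s) / 2.
have r0 : 0 < r.
  rewrite /r; case: (posnP i) => // i0.
  by have := inc i i.+1 i0 (ltnSn _); rewrite /b; lra.
(* The bound 1 keeps the persisting zero below the limit [b + 2] of the family. *)
pose m := Num.min (Num.min e r) 1.
have m0 : 0 < m by rewrite !lt_min e0 r0 ltr01.
have me : m <= e by rewrite !ge_min lexx.
have mr : m <= r by rewrite !ge_min lexx orbT.
have m1 : m <= 1 by rewrite !ge_min lexx !orbT.
have [d d0 hd] := boundary_zero_persists hDE bL eb m0.
have [d' d'0 hd'] : exists2 d', 0 < d' & forall s' : R, `|s' - s| < d' ->
    (0 < i)%N -> mu i g s' < mu i g s + r.
  case: (posnP i) => [->|i0]; first by exists 1.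
  by have [d' d'0 hd'] := IH r i0 r0; exists d' => // s' /hd'.
exists (Num.min d d'); first by rewrite lt_min d0.
move=> s'; rewrite lt_min => /andP[sd sd'].
have sd1 : `|- s' - - s| < d by rewrite -opprD normrN.
have [[l /andP[l1 l2] el] _] := hd _ sd1.
apply: (@le_lt_trans _ _ l); last by rewrite -/b; lra.
apply: eigenvalue_rank => //.
  by apply/(robin_eigenvalue_boundary hDE) => //; lra.
rewrite ltnS => i0; have := hd' s' sd' i0.
by rewrite /=; move: mr; rewrite /r gtn_eqF//; lra.
Qed.

(* Feynman-Hellmann in disguise: when the identity fails, the boundary
   condition is crossed transversally as sigma varies, which pushes an
   eigenvalue below the minimum. *)
Lemma eigenvalue_at_minimum (j : nat) (g s : R) : (0 < j)%N ->
  unique_minimum_at (mu j g) s -> mu j g s = s ^+ 2 - g ^+ 2.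
Proof.
case: j => // j _ hmin; apply/eqP; apply: contrapT => /negP ne.
have [inc spec] := hmu g s.
pose b := mu j.+1 g s.
have [D [E hDE]] := exists_weber_family (b + 1).
have bL : b < b + 1 by lra.
have eb : E b (- s) - g * D b (- s) = 0.
  by apply/(robin_eigenvalue_boundary hDE) => //; apply/spec; exists j.+1.
pose r : R := if (j == 0)%N then 1 else (b - mu j g s) / 2.
have r0 : 0 < r.
  rewrite /r; case: (posnP j) => // j0.
  by have := inc j j.+1 j0 (ltnSn _); rewrite /b; lra.
have [d d0 hd] := boundary_zero_persists hDE bL eb r0.
have [d' d'0 hd'] : exists2 d', 0 < d' & forall s' : R, `|s' - s| < d' ->
    (0 < j)%N -> mu j g s' < mu j g s + r.
  case: (posnP j) => [->|i0]; first by exists 1.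
  by have [d' d'0 h] := eigenvalue_usc g s i0 r0; exists d' => // s' /h.
have m0 : 0 < Num.min d d' by rewrite lt_min d0.
have ne' : (- s) ^+ 2 - b - g ^+ 2 != 0.
  by apply: contraNneq ne => e; apply/eqP; rewrite -/b; rewrite sqrrN in e; lra.
have [y] := boundary_crosses hDE bL eb ne' m0.
rewrite lt_min => /andP[yd yd'] pos.
have [_ /(_ pos)[l /andP[l1 l2] el]] := hd y yd.
(* The boundary point in the variable [x] is minus sigma, so [y] near [- s] corresponds to the
   parameter [- y] near [s]. *)
have ev : robin_eigenvalue g (- y) l.
  by apply/(robin_eigenvalue_boundary hDE); rewrite ?opprK//; lra.
have ns : `|- y - s| < d' by rewrite -normrN opprB opprK addrC -(opprK s).
have le : mu j.+1 g (- y) <= l.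
  apply: eigenvalue_rank => //; rewrite ltnS => j0; have := hd' _ ns j0.
  by rewrite /=; move: l1; rewrite /r gtn_eqF//; lra.
(* Since [l < b], [le] puts the eigenvalue at [- y] below [b]. This contradicts minimality if [- y]
   differs from [s], and the definition of [b] otherwise. *)
have := hmin (- y); case: eqVneq => [e|_ /(_ isT)]; last by rewrite -/b; lra.
by move: le; rewrite e -/b; lra.
Qed.

End eigenvalue_curves.

(** * The function C at the minimum *)

Section at_minimum.
Context (R : realType) (L : R) (D E : R -> R -> R) (hDE : weber_family L D E)
  (g s l : R) (lL : l < L) (bc : E l (- s) - g * D l (- s) = 0)
  (lE : l = s ^+ 2 - g ^+ 2).

(** The energy [h = (x^2 - l) D^2 - E^2] has derivative [2 x D^2], vanishes at [- s] because
    [l = s^2 - g^2], and tends to 0 at infinity. If [s <= 0], it is monotone on [[- s, +oo[], hence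
    identically 0 there, although [D] is not. *)
Lemma minimum_gt0 : 0 < s.
Proof.
have [hD hE _ [rD rE] _] := hDE.
rewrite ltNge; apply/negP => s0.
pose h x := (x ^+ 2 - l) * D l x ^+ 2 - E l x ^+ 2.
have dh x : is_derive x (1 : R) h (2 * x * D l x ^+ 2).
  have d1 := hD l x lL; have d2 := hE l x lL.
  by rewrite /h; der; ring.
have hs : h (- s) = 0.
  have e : E l (- s) = g * D l (- s) by move/eqP: bc; rewrite subr_eq0 => /eqP.
  by rewrite /h e lE; ring.
have rx2 : rapid L (fun k x => ('X^2 - l%:P).[x] * D k x) by exact: rapid_poly.
have [C1 C10 hC1] := rapid_mul_decay2 (- s) rx2 rD lL lL.
have [C2 C20 hC2] := rapid_mul_decay2 (- s) rE rE lL lL.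
have h0 x : - s <= x -> h x = 0.
  move=> sx; apply/eqP; rewrite eq_le; apply/andP; split.
    apply: (@ndecr_decay_le0 _ h x (C1 + C2)).
      move=> y xy; apply: (global_derivative_ge0_le dh) => // z xz _.
      have z0 : 0 <= z by lra.
      by apply: mulr_ge0 (sqr_ge0 _); exact: mulr_ge0.
    move=> y xy; have sy := le_trans sx xy.
    have := hC1 y sy; have := hC2 y sy; rewrite !hornerE => h2 h1.
    rewrite /h (le_trans (ler_normB _ _))// [leRHS]mulrDl; apply: lerD.
      by move: h1; rewrite expr2 mulrA.
    by rewrite expr2.
  rewrite -hs; apply: (global_derivative_ge0_le dh) => // z sz _.
  have z0 : 0 <= z by lra.
  by apply: mulr_ge0 (sqr_ge0 _); exact: mulr_ge0.
(* The shift by 1 makes [y] positive and leaves a neighbourhood of radius 1 inside the region where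
   [h] vanishes. *)
have [y sy Dy] := weber_neq0_right hDE (- s + 1) lL.
have dn : 2 * y * D l y ^+ 2 != 0.
  by rewrite mulf_neq0 ?sqrf_eq0// mulf_neq0//; apply/eqP; lra.
have [|z] := derivative_neq0_gt0 ltr01 (fun x => @ex_derive _ _ _ _ _ _ _ (dh x))
  (dh y) dn; first by apply: h0; lra.
rewrite ltr_norml => /andP[z1 z2]; rewrite h0 ?ltxx//; lra.
Qed.

(* Antiderivative [a u^2 + b u u' + k u'^2] of the integrand of [Cfun], found by
   undetermined coefficients: [k] is even, [b = - k'] and
   [2 a = - 1 - b' - 2 (x^2 - l) k]. *)
Definition C_coef2 (x : R) : R := x ^+ 2 / 6 + (l / 3 - s ^+ 2 / 2).
Definition C_primitive (x : R) : R :=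
  (- 1 / 3 - C_coef2 x * (x ^+ 2 - l)) * D l x ^+ 2
  - x / 3 * (D l x * E l x) + C_coef2 x * E l x ^+ 2.

(** In the variable [x = tau - s], the coefficient [x (x + s)^2 - 2 (x + s) x^2] collapses to this
    odd cubic. *)
Definition C_integrand (x : R) : R :=
  (- x ^+ 3 + s ^+ 2 * x) * D l x ^+ 2 - E l x * D l x.

Lemma is_derive_C_primitive (x : R) :
  is_derive x (1 : R) C_primitive (C_integrand x).
Proof.
have [hD hE _ _ _] := hDE.
have d1 := hD l x lL; have d2 := hE l x lL.
rewrite /C_primitive /C_coef2 /C_integrand; der.
by field.
Qed.

(** At [x = - s] the relation [l = s^2 - g^2] gives [x^2 - l = g^2] and [C_coef2 x = - g^2 / 3], so
    the terms in [g^4] coming from [D^2] and from [E = g D] cancel. *)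
Lemma C_primitive_boundary : C_primitive (- s) = (g * s - 1) / 3 * D l (- s) ^+ 2.
Proof.
have e : E l (- s) = g * D l (- s) by move/eqP: bc; rewrite subr_eq0 => /eqP.
by rewrite /C_primitive /C_coef2 e lE; field.
Qed.

Lemma Rintegral_C (c : R) :
  \int[@lebesgue_measure R]_(t in `[0, +oo[) (c ^+ 2 * C_integrand (t - s)) =
  (1 - g * s) / 3 * (c ^+ 2 * D l (- s) ^+ 2) /\
  (@lebesgue_measure R).-integrable `[0, +oo[
     (EFin \o (fun t => c ^+ 2 * C_integrand (t - s))).
Proof.
have [hD hE _ [rD rE] _] := hDE.
(* The coefficients are recast as formal polynomials so that [rapid_poly] controls each term of the
   primitive and of the integrand. *)
have [k kE] : exists k : {poly R}, forall x, k.[x] = C_coef2 x.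
  exists ((1 / 6)%:P * 'X^2 + (l / 3 - s ^+ 2 / 2)%:P) => x.
  by rewrite /C_coef2 !(hornerD, hornerM, hornerC, hornerX); field.
have r1 : rapid L (fun m x => ((- 1 / 3)%:P - k * ('X^2 - l%:P)).[x] * D m x).
  exact: rapid_poly.
have r2 : rapid L (fun m x => (- (1 / 3)%:P * 'X).[x] * E m x) by exact: rapid_poly.
have r3 : rapid L (fun m x => k.[x] * E m x) by exact: rapid_poly.
have r4 : rapid L (fun m x => (- 'X^3 + (s ^+ 2)%:P * 'X).[x] * D m x - E m x).
  exact: rapidD (rapid_poly _ rD) (rapidN rE).
have [C1 C10 hC1] := rapid_mul_decay2 (- s) r1 rD lL lL.
have [C2 C20 hC2] := rapid_mul_decay2 (- s) r2 rD lL lL.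
have [C3 C30 hC3] := rapid_mul_decay2 (- s) r3 rE lL lL.
have [C4 C40 hC4] := rapid_mul_decay2 (- s) r4 rD lL lL.
(* Dominates the primitive through [C1 + C2 + C3] and the integrand through [C4]; [expR s] comes
   from [x = t - s]. *)
pose C := c ^+ 2 * (C1 + C2 + C3 + C4) * expR s.
have c0 := sqr_ge0 c.
have eexp (t : R) : expR (- (t - s)) = expR s * expR (- t).
  by rewrite -expRD; congr expR; ring.
have hP t : 0 <= t -> `|c ^+ 2 * C_primitive (t - s)| <= C * expR (- t).
  move=> t0; have st : - s <= t - s by lra.
  have := hC1 _ st; have := hC2 _ st; have := hC3 _ st.
  rewrite !eexp => h3 h2 h1; rewrite normrM (ger0_norm c0) /C.
  rewrite -!(mulrA (c ^+ 2)); apply: ler_wpM2l => //.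
  have e4 : 0 <= C4 * (expR s * expR (- t)) by rewrite !mulr_ge0// expR_ge0.
  have -> : C_primitive (t - s) =
    (((- 1 / 3)%:P - k * ('X^2 - l%:P)).[t - s] * D l (t - s) * D l (t - s) +
     (- (1 / 3)%:P * 'X).[t - s] * E l (t - s) * D l (t - s)) +
     k.[t - s] * E l (t - s) * E l (t - s).
    rewrite !(hornerD, hornerN, hornerM, hornerC, hornerXn, hornerX) kE.
    by rewrite /C_primitive; field.
  apply: (le_trans (ler_normD _ _)); apply: (@le_trans _ _
    ((C1 + C2 + C3) * (expR s * expR (- t)))); last by lra.
  rewrite !mulrDl; apply: lerD => //; apply: (le_trans (ler_normD _ _)).
  exact: lerD.
have hI t : 0 <= t -> `|c ^+ 2 * C_integrand (t - s)| <= C * expR (- t).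
  move=> t0; have st : - s <= t - s by lra.
  have := hC4 _ st.
  rewrite !eexp => h4; rewrite normrM (ger0_norm c0) /C.
  rewrite -!(mulrA (c ^+ 2)); apply: ler_wpM2l => //.
  have e0 : 0 <= (C1 + C2 + C3) * (expR s * expR (- t)).
    by rewrite !mulr_ge0// ?expR_ge0// !addr_ge0.
  have -> : C_integrand (t - s) =
    ((- 'X^3 + (s ^+ 2)%:P * 'X).[t - s] * D l (t - s) - E l (t - s)) * D l (t - s).
    by rewrite !hornerE /C_integrand; ring.
  by apply: (le_trans h4); lra.
have dP t : is_derive t (1 : R) (fun t => c ^+ 2 * C_primitive (t - s))
    (c ^+ 2 * C_integrand (t - s)).
  by have d := is_derive_C_primitive; der; ring.
have cI t : {for t, continuous (fun t => c ^+ 2 * C_integrand (t - s))}.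
  have d1 y := hD l y lL; have d2 y := hE l y lL.
  apply: (@is_derive_continuous _ _ _ _); rewrite /C_integrand; der; reflexivity.
split; last first.
  by apply: (integrable_decay _ hI); apply: continuous_measurable_on.
rewrite (@Rintegral_decay _ _ _ _ _ (fun t _ => dP t) _ _ hP hI).
- by rewrite sub0r C_primitive_boundary; field.
- exact: continuous_within.
- apply: cvg_at_right_filter; exact: is_derive_continuous (dP 0).
Qed.

End at_minimum.

Lemma Cfun_at_minimum (R : realType) (g s l : R) (u : R -> R) :
  l = s ^+ 2 - g ^+ 2 -> normalized_eigenfunction g s l u ->
  0 < s /\ exists2 k, 0 < k & Cfun s u = k * (1 - g * s).
Proof.
move=> lE hu; have [D [E hDE]] := exists_weber_family (l + 1).
have lL : l < l + 1 by lra.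
have [bc [c [c0 uc du]]] := normalized_eigenfunction_weber hDE lL hu.
have s0 := minimum_gt0 hDE lL bc lE; split => //.
(* This is [u 0 ^+ 2 / 3]. It is positive since the boundary condition with [D = 0] would also give
   [E = 0]. *)
exists (c ^+ 2 * D l (- s) ^+ 2 / 3).
  rewrite divr_gt0// mulr_gt0// exprn_even_gt0//=.
  exact: (weber_at_zero hDE lL bc).
have [eC iC] := Rintegral_C hDE lL bc lE c.
(* The point 0 is discarded because the two-sided derivative of [u] there depends on irrelevant
   values. *)
have iC' : (@lebesgue_measure R).-integrable `]0, +oo[
    (EFin \o (fun t => c ^+ 2 * C_integrand D E s l (t - s))).
  apply: integrableS iC => //.
  by apply: subset_itvr; rewrite bnd_simp.
pose F tau := ((tau - s) * tau ^+ 2 * u tau - derive1 u tau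
                        - 2 * tau * (s - tau) ^+ 2 * u tau) * u tau.
have FE : {in `]0, +oo[%classic, (fun t => c ^+ 2 * C_integrand D E s l (t - s)) =1 F}.
  move=> t; rewrite inE/= in_itv/= andbT => t0.
  have d := du t t0.
  rewrite /F derive1E derive_val uc ?ltW// /C_integrand.
  by ring.
have iF : (@lebesgue_measure R).-integrable `]0, +oo[ (EFin \o F).
  apply: eq_integrable iC' => // t tt /=; congr EFin; exact: FE.
have -> : Cfun s u = \int[@lebesgue_measure R]_(t in `]0, +oo[)
    (c ^+ 2 * C_integrand D E s l (t - s)).
  transitivity (\int[@lebesgue_measure R]_(t in `]0, +oo[) F t).
    by rewrite Rintegral_itv_obnd_cbnd.
  exact/esym/eq_Rintegral.
by rewrite Rintegral_itv_obnd_cbnd// eC; field.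
Qed.

(** * The threshold, from the monotonicity of [gamma * xi(gamma)] *)

Theorem propositionB5 (R : realType)
  (mu : nat -> R -> R -> R) (u : nat -> R -> R -> R -> R) (xi : nat -> R -> R)
  (hmu : forall gamma sigma : R,
     robin_spectrum gamma sigma (fun j => mu j gamma sigma))
  (hu : forall (j : nat) (gamma sigma : R), (1 <= j)%N ->
     normalized_eigenfunction gamma sigma (mu j gamma sigma) (u j gamma sigma))
  (hxi : forall (j : nat) (gamma : R), (1 <= j)%N ->
     unique_minimum_at (mu j gamma) (xi j.-1 gamma))
  (j : nat) (hj : (1 <= j)%N) :
  exists gamma0 : R, 0 < gamma0 /\
    forall gamma : R,
      (gamma < gamma0 ->
         0 < Cfun (xi j.-1 gamma) (u j gamma (xi j.-1 gamma))) /\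
      (gamma0 < gamma ->
         Cfun (xi j.-1 gamma) (u j gamma (xi j.-1 gamma)) < 0).
Proof.
pose x := xi j.-1.
have muE g : mu j g (x g) = x g ^+ 2 - g ^+ 2.
  by apply: (eigenvalue_at_minimum hmu) => //; exact: hxi.
have x_gt0 g : 0 < x g by have [] := Cfun_at_minimum (muE g) (hu j g (x g) hj).
have C_pos g : (0 < Cfun (x g) (u j g (x g))) = (g * x g < 1).
  have [_ [k k0 ->]] := Cfun_at_minimum (muE g) (hu j g (x g) hj).
  by rewrite pmulr_rgt0// subr_gt0.
have C_neg g : (Cfun (x g) (u j g (x g)) < 0) = (1 < g * x g).
  have [_ [k k0 ->]] := Cfun_at_minimum (muE g) (hu j g (x g) hj).
  by rewrite pmulr_rlt0// subr_lt0.
have min_lt g g' : g < g' -> mu j g (x g) < mu j g' (x g').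
  (* Compares through the intermediate value [mu j g (x g')]. *)
  move=> gg'; apply: le_lt_trans (eigenvalue_lt_gamma hmu _ gg' hj).
  have [->//|ne] := eqVneq (x g') (x g).
  exact/ltW/(hxi j g hj).
have x_lt g g' : 0 <= g -> g < g' -> x g < x g'.
  move=> g0 gg'; have := min_lt _ _ gg'; rewrite !muE => h.
  have x0 := x_gt0 g; have x0' := x_gt0 g'.
  rewrite ltNge; apply/negP => le.
  by have := ler_pM (ltW x0') (ltW x0') le le; nra.
have gx_lt g g' : 0 <= g -> g < g' -> g * x g < g' * x g'.
  move=> g0 gg'; apply: ltr_pM => //; [exact: ltW|exact: x_lt].
pose S := [set g | 0 <= g /\ g * x g < 1].
have S0 : S 0 by split; rewrite // mul0r.
(* If [g > 1 / x 0], then [g * x g > g * x 0 > 1]. *)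
have ubS : ubound S (x 0)^-1.
  move=> g [g0 gx]; rewrite leNgt; apply/negP => gt.
  have x0 := x_gt0 0; have gpos : 0 < g by apply: lt_trans gt; rewrite invr_gt0.
  have : 1 < g * x 0 by rewrite -ltr_pdivrMr ?div1r.
  have : g * x 0 < g * x g by rewrite ltr_pM2l// x_lt.
  by lra.
have hS : has_sup S by split; [exists 0|exists (x 0)^-1].
exists (sup S); split.
  (* A positive member of [S]: being less than 1 gives [x g < x 1], and the second bound gives
     [g * x 1 <= 1 / 2]. *)
  pose g := Num.min (1 / 2) (1 / 2 / x 1).
  have g0 : 0 < g by rewrite lt_min !divr_gt0.
  apply: (lt_le_trans g0); apply: ub_le_sup; first by exists (x 0)^-1.
  have g1 : g < 1 by rewrite gt_min; apply/orP; left; lra.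
  split; first exact: ltW.
  have : g * x g < g * x 1 by rewrite ltr_pM2l// x_lt// ltW.
  have : g * x 1 <= 1 / 2 by rewrite -ler_pdivlMr// ge_min lexx orbT.
  by lra.
move=> g; rewrite -/(x g) C_pos C_neg; split => gS.
  have [g0|g0] := ltP g 0.
    by have := x_gt0 g => xg; rewrite (@lt_trans _ _ 0)// nmulr_rlt0.
  have e0 : 0 < sup S - g by rewrite subr_gt0.
  have [g' [g'0 g'x] gg'] := sup_adherent e0 hS.
  have {}gg' : g < g' by lra.
  by apply: lt_trans g'x; exact: gx_lt.
rewrite ltNge; apply/negP => gx.
have s0 : 0 <= sup S by apply: ub_le_sup => //; exists (x 0)^-1.
(* If [g * x g <= 1], strict monotonicity puts this midpoint in [S], above its supremum. *)
pose g' := (sup S + g) / 2.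
have g'g : g' < g by rewrite /g'; lra.
have g'0 : 0 <= g' by rewrite /g'; lra.
have : g' <= sup S.
  apply: ub_le_sup; first by exists (x 0)^-1.
  by split => //; apply: lt_le_trans gx; exact: gx_lt.
by rewrite /g'; lra.
Qed.
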